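(* For $0<\operatorname{Re}\beta<1$, $\operatorname{Re}\gamma>0$, and $a>0$, $$\int_0^\infty \frac{\cos ax}{\cosh\pi x+\cos\pi\beta}\,\frac{dx}{x^2+\gamma^2}=\frac{\pi e^{-a\gamma}}{2\gamma(\cos\gamma\pi+\cos\beta\pi)}+\frac{1}{\sin\beta\pi}\sum_{k=0}^\infty\left[\frac{e^{-(2k+1-\beta)a}}{\gamma^2-(2k+1-\beta)^2}-\frac{e^{-(2k+1+\beta)a}}{\gamma^2-(2k+1+\beta)^2}\right].$$ *)

(* Defs.v *)
From Stdlib Require Import Reals.
From Coquelicot Require Import Coquelicot.

Open Scope C_scope.

Definition Cexp (z : C) : C := RtoC (exp (Re z)) * (cos (Im z), sin (Im z)).

Definition Ccos (z : C) : C := (Cexp (Ci * z) + Cexp (- (Ci * z))) / 2.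

Definition Csin (z : C) : C := (Cexp (Ci * z) - Cexp (- (Ci * z))) / (2 * Ci).

(* Improper Riemann integral over [0, +oo), with C viewed as a normed module
   over R. *)
Definition is_CInt_0_infty (f : R -> C) (l : C) : Prop :=
  @is_RInt_gen C_R_NormedModule f (at_point 0%R) (Rbar_locally p_infty) l.

Definition integrand (beta gamma : C) (a x : R) : C :=
  RtoC (cos (a * x)) / (RtoC (cosh (PI * x)) + Ccos (PI * beta))
  * (1 / (RtoC x ^ 2 + gamma ^ 2)).

Definition series_term (beta gamma : C) (a : R) (k : nat) : C :=
  let n := RtoC (2 * INR k + 1) in
  Cexp (- ((n - beta) * a)) / (gamma ^ 2 - (n - beta) ^ 2)
  - Cexp (- ((n + beta) * a)) / (gamma ^ 2 - (n + beta) ^ 2).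

(* Main.v *)
(** Put b_k = 2k+1-beta and c_k = 2k+1+beta.  The Mittag-Leffler expansion
    (pi/2) sin(beta pi) / (cos(pi z) + cos(beta pi))
      = sum_k [b_k / (b_k^2 - z^2) - c_k / (c_k^2 - z^2)]
    at z = i x converges at the rate O(1/N) uniformly in the real variable x, so it
    may be multiplied by cos(a x) / (x^2 + gamma^2) and integrated termwise.  Partial
    fractions reduce every term to int_0^oo cos(a x) / (x^2 + b^2) dx = pi e^(-ab) / (2b),
    Re b > 0; the coefficients of e^(-a gamma) sum up by the same expansion at z = gamma.

    The expansion is half the sum of those of tan(pi (beta + z) / 2) and
    tan(pi (beta - z) / 2).  For the tangent let I_n(w) be the integral of
    cos(w t) cos^n t over [0, pi/2]: the recursion (n^2 - w^2) I_n = n (n-1) I_(n-2) and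
    its logarithmic derivative in w produce the partial sums, with remainder -I_n'/I_n = O(1/n).

    For the cosine integral let Y(u) be the integral of cos(u x) / (x^2 + b^2) over
    [0, X] and Q = Y' + b Y.  Then Q' - b Q = - sin(u X) / u, and since Q is bounded
    in u it is O(1/X) on every [d, oo), d > 0; so Y(a) is close to e^(-b(a-d)) Y(d),
    and d -> 0 leaves the integral of 1 / (x^2 + b^2). *)

Require Import Defs.
From Stdlib Require Import Reals Lra Lia Psatz.
From Coquelicot Require Import Coquelicot.

Open Scope C_scope.

(** * Calculus of functions from R to C *)

(** The cutoff X is forced. On the half line the first u-derivative of the cosine integral converges
    only conditionally and the second diverges, while on [0, X] both exist and the price is the
    boundary term sin(uX)/u. That term is not small as X grows, but its integral in u is, and this
    is what makes Q of size 1/X.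

    Taken alone, b_k / (b_k^2 - z^2) and c_k / (c_k^2 - z^2) are only O(1/k). Since c_k - b_k = 2
    beta does not grow, their difference is O(1/k^2), uniformly in x on the axis z = i x. Against a
    weight bounded by a multiple of 1/(1 + x^2), the truncated integrals of the partial sums then
    converge uniformly in X, and the limits in N and X may be exchanged.

    The assumption cos(gamma pi) + cos(beta pi) <> 0 does several jobs at once: the sum is twice a
    product of two cosines, so both tangents are finite, hence the integrals I_n do not vanish along
    the recursion, and no denominator gamma^2 - b_k^2 or gamma^2 - c_k^2 is zero. *)

Lemma C_ext (x y : C) : Re x = Re y -> Im x = Im y -> x = y.
Proof. destruct x, y; simpl; intros; subst; reflexivity. Qed.

Definition is_derive_C (f : R -> C) (t : R) (l : C) : Prop :=
  is_derive (fun x => Re (f x)) t (Re l) /\ is_derive (fun x => Im (f x)) t (Im l).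

Definition continuous_C (f : R -> C) (t : R) : Prop :=
  continuous (fun x => Re (f x)) t /\ continuous (fun x => Im (f x)) t.

Lemma is_derive_C_eq f t l l' : is_derive_C f t l -> l = l' -> is_derive_C f t l'.
Proof. intros H <-; exact H. Qed.

Lemma is_derive_C_ext f g t l :
  (forall x, f x = g x) -> is_derive_C f t l -> is_derive_C g t l.
Proof.
  intros E [H1 H2]; split; [eapply is_derive_ext, H1|eapply is_derive_ext, H2];
    intros x; simpl; now rewrite E.
Qed.

Lemma is_derive_C_RtoC (f : R -> R) t l :
  is_derive f t l -> is_derive_C (fun x => RtoC (f x)) t (RtoC l).
Proof. intros H; split; simpl; [exact H|]. exact (is_derive_const 0%R t). Qed.

Lemma is_derive_C_const c t : is_derive_C (fun _ => c) t 0.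
Proof. split; [exact (is_derive_const (Re c) t)|exact (is_derive_const (Im c) t)]. Qed.

Lemma is_derive_C_id t : is_derive_C (fun x => RtoC x) t 1.
Proof. apply (is_derive_C_RtoC (fun x => x)), @is_derive_id. Qed.

Lemma is_derive_C_plus f g t l m :
  is_derive_C f t l -> is_derive_C g t m -> is_derive_C (fun x => f x + g x) t (l + m).
Proof. intros [] []; split; now apply @is_derive_plus. Qed.

Lemma is_derive_C_minus f g t l m :
  is_derive_C f t l -> is_derive_C g t m -> is_derive_C (fun x => f x - g x) t (l - m).
Proof. intros [] []; split; now apply @is_derive_minus. Qed.

Lemma is_derive_C_mult f g t l m :
  is_derive_C f t l -> is_derive_C g t m ->
  is_derive_C (fun x => f x * g x) t (l * g t + f t * m).
Proof.
  intros [H1 H2] [H3 H4]; split.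
  - evar_last.
    + apply @is_derive_minus; apply @is_derive_mult; try exact Rmult_comm; eassumption.
    + unfold minus, plus, opp, mult; simpl; unfold Re, Im; ring.
  - evar_last.
    + apply @is_derive_plus; apply @is_derive_mult; try exact Rmult_comm; eassumption.
    + unfold minus, plus, opp, mult; simpl; unfold Re, Im; ring.
Qed.

Lemma C_sqr_pos (z : C) : z <> 0 -> (0 < Re z ^ 2 + Im z ^ 2)%R.
Proof.
  intros H; rewrite <- Cmod2_alt. apply pow_lt, Cmod_gt_0, H.
Qed.

(** 1/f is the conjugate of f over |f|^2, so both components are real quotients with the denominator
    [Re f ^ 2 + Im f ^ 2]. *)
Lemma is_derive_C_inv f t l :
  is_derive_C f t l -> f t <> 0 -> is_derive_C (fun x => / f x) t (- l / f t ^ 2).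
Proof.
  intros [H1 H2] H0; pose proof (C_sqr_pos _ H0) as Hp.
  assert (Hp' : (Re (f t) ^ 2 + Im (f t) ^ 2)%R <> 0%R) by lra.
  assert (E : - l / f t ^ 2 = - l * (/ f t * / f t)) by (field; assumption).
  rewrite E.
  assert (Hd : is_derive (fun x => Re (f x) ^ 2 + Im (f x) ^ 2)%R t
    (2 * Re l * Re (f t) + 2 * Im l * Im (f t))%R).
  { evar_last; [apply @is_derive_plus; apply is_derive_pow; eassumption|].
    unfold plus; simpl; ring. }
  split.
  - evar_last.
    + exact (is_derive_div _ _ t _ _ H1 Hd Hp').
    + unfold Re, Im in *; simpl in *; field; repeat split; intros K; apply Hp'; lra.
  - evar_last.
    + exact (is_derive_div _ _ t _ _ (is_derive_opp _ _ _ H2) Hd Hp').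
    + unfold opp; unfold Re, Im in *; simpl in *; field; repeat split; intros K; apply Hp'; lra.
Qed.

Lemma is_derive_C_div f g t l m :
  is_derive_C f t l -> is_derive_C g t m -> g t <> 0 ->
  is_derive_C (fun x => f x / g x) t ((l * g t - f t * m) / g t ^ 2).
Proof.
  intros Hf Hg H0; eapply is_derive_C_eq.
  - apply is_derive_C_mult; [exact Hf|apply is_derive_C_inv; eassumption].
  - cbv beta. field; exact H0.
Qed.

Lemma is_derive_C_Cexp f t l :
  is_derive_C f t l -> is_derive_C (fun x => Cexp (f x)) t (l * Cexp (f t)).
Proof.
  intros [H1 H2].
  assert (He : is_derive (fun x => exp (Re (f x))) t (Re l * exp (Re (f t)))%R).
  { apply (is_derive_comp exp (fun x => Re (f x))); [apply is_derive_exp|exact H1]. }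
  assert (Hc : is_derive (fun x => cos (Im (f x))) t (Im l * - sin (Im (f t)))%R).
  { apply (is_derive_comp cos (fun x => Im (f x))); [apply is_derive_cos|exact H2]. }
  assert (Hs : is_derive (fun x => sin (Im (f x))) t (Im l * cos (Im (f t)))%R).
  { apply (is_derive_comp sin (fun x => Im (f x))); [apply is_derive_sin|exact H2]. }
  eapply is_derive_C_eq.
  - unfold Cexp. apply is_derive_C_mult; [apply is_derive_C_RtoC; exact He|].
    instantiate (1 := (Im l * - sin (Im (f t)), Im l * cos (Im (f t)))%R).
    split; simpl; assumption.
  - unfold Cexp; apply C_ext; simpl; unfold Re, Im; ring.
Qed.

Lemma Cexp_plus (x y : C) : Cexp (x + y) = Cexp x * Cexp y.
Proof.
  unfold Cexp; apply C_ext; simpl; rewrite exp_plus, cos_plus, sin_plus; unfold Re, Im; ring.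
Qed.

Lemma Cexp_0 : Cexp 0 = 1.
Proof. unfold Cexp; apply C_ext; simpl; rewrite exp_0, ?cos_0, ?sin_0; ring. Qed.

Lemma Cmod_Cexp (z : C) : Cmod (Cexp z) = exp (Re z).
Proof.
  unfold Cexp; rewrite Cmod_mult, Cmod_R, (Rabs_pos_eq _ (Rlt_le _ _ (exp_pos _))).
  unfold Cmod; simpl.
  replace (_ + _)%R with ((Rsqr (sin (Im z)) + Rsqr (cos (Im z))))%R by (unfold Rsqr; ring).
  rewrite sin2_cos2, sqrt_1; ring.
Qed.

Lemma Cexp_neq_0 (z : C) : Cexp z <> 0.
Proof. apply Cmod_gt_0; rewrite Cmod_Cexp; apply exp_pos. Qed.

Lemma Cexp_opp (z : C) : Cexp (- z) = / Cexp z.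
Proof.
  assert (H : Cexp z * Cexp (- z) = 1).
  { rewrite <- Cexp_plus, <- Cexp_0; f_equal; ring. }
  pose proof (Cexp_neq_0 z).
  rewrite <- (Cmult_1_l (/ _)), <- H; field; assumption.
Qed.

(* Rotating [f T - f u] onto the real axis reduces the claim to monotonicity of a real function. *)
Lemma Cmod_increment_le (f f' : R -> C) (g g' : R -> R) (u T : R) :
  (u <= T)%R ->
  (forall t, (u <= t <= T)%R -> is_derive_C f t (f' t)) ->
  (forall t, (u <= t <= T)%R -> is_derive g t (g' t)) ->
  (forall t, (u <= t <= T)%R -> (Cmod (f' t) <= g' t)%R) ->
  (Cmod (f T - f u) <= g T - g u)%R.
Proof.
  intros HuT Hf Hg Hle.
  set (d := f T - f u).
  (* The unit vector along [d]. For [d = 0] the zero vector serves, which is why only an inequality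
     is asked of its length. *)
  assert (exists al be, (al ^ 2 + be ^ 2 <= 1)%R /\ (al * Re d + be * Im d = Cmod d)%R)
    as (al & be & Hab & Hd).
  { destruct (Ceq_dec d 0) as [->|Hd0].
    - exists 0%R, 0%R; rewrite Cmod_0; split; lra.
    - assert (Hm := proj1 (Cmod_gt_0 d) Hd0).
      pose proof (Cmod2_alt d) as Hs.
      exists (Re d / Cmod d)%R, (Im d / Cmod d)%R; split.
      + replace (_ + _)%R with ((Re d ^ 2 + Im d ^ 2) / Cmod d ^ 2)%R by (field; lra).
        rewrite <- Hs. right; field; lra.
      + replace (_ + _)%R with ((Re d ^ 2 + Im d ^ 2) / Cmod d)%R by (field; lra).
        rewrite <- Hs; field; lra. }
  set (h := fun t => (g t - (al * Re (f t) + be * Im (f t)))%R).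
  destruct (MVT_gen h u T (fun t => g' t - (al * Re (f' t) + be * Im (f' t)))%R) as (c & Hc & He).
  - rewrite Rmin_left, Rmax_right by lra; intros x Hx.
    apply @is_derive_minus; [apply Hg; lra|].
    apply @is_derive_plus; apply is_derive_scal; apply Hf; lra.
  - rewrite Rmin_left, Rmax_right by lra; intros x Hx.
    apply continuity_pt_filterlim, @ex_derive_continuous. eexists.
    apply @is_derive_minus; [apply Hg; lra|].
    apply @is_derive_plus; apply is_derive_scal; apply Hf; lra.
  - rewrite Rmin_left, Rmax_right in Hc by lra.
    assert (Hpos : (al * Re (f' c) + be * Im (f' c) <= Cmod (f' c))%R).
    { pose proof (Cmod2_alt (f' c)); pose proof (Cmod_ge_0 (f' c)).
      apply Rsqr_incr_0_var; [|assumption]. unfold Rsqr.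
      (* Cauchy-Schwarz through Lagrange's identity: this square is the defect of the inequality. *)
      assert (0 <= (al * Im (f' c) - be * Re (f' c)) ^ 2)%R by apply pow2_ge_0.
      nra. }
    specialize (Hle c Hc).
    assert (0 <= h T - h u)%R.
    { rewrite He; apply Rmult_le_pos; lra. }
    unfold h in H. unfold d, Re, Im in *; simpl in Hd. fold d in Hd |- *. lra.
Qed.

(** * Integrals of complex-valued functions over bounded intervals *)

Definition is_CInt (f : R -> C) (a b : R) (l : C) : Prop :=
  @is_RInt C_R_NormedModule f a b l.

Lemma is_CInt_fst f a b l : is_CInt f a b l -> is_RInt (fun x => Re (f x)) a b (Re l).
Proof. apply @is_RInt_fct_extend_fst. Qed.
Lemma is_CInt_snd f a b l : is_CInt f a b l -> is_RInt (fun x => Im (f x)) a b (Im l).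
Proof. apply @is_RInt_fct_extend_snd. Qed.
Lemma is_CInt_pair f a b l :
  is_RInt (fun x => Re (f x)) a b (Re l) -> is_RInt (fun x => Im (f x)) a b (Im l) ->
  is_CInt f a b l.
Proof. intros; destruct l; now apply @is_RInt_fct_extend_pair. Qed.

Lemma is_CInt_ext f g a b l : (a <= b)%R ->
  (forall x, (a < x < b)%R -> f x = g x) -> is_CInt f a b l -> is_CInt g a b l.
Proof.
  intros Hab E; apply @is_RInt_ext; rewrite Rmin_left, Rmax_right by lra; exact E.
Qed.

Lemma is_CInt_eq f a b l l' : is_CInt f a b l -> l = l' -> is_CInt f a b l'.
Proof. intros H <-; exact H. Qed.

Lemma is_CInt_plus f g a b l m :
  is_CInt f a b l -> is_CInt g a b m -> is_CInt (fun x => f x + g x) a b (l + m).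
Proof. apply @is_RInt_plus. Qed.

Lemma is_CInt_minus f g a b l m :
  is_CInt f a b l -> is_CInt g a b m -> is_CInt (fun x => f x - g x) a b (l - m).
Proof. apply @is_RInt_minus. Qed.

(** The integral lives in a module over the reals; a complex factor mixes the two components, so
    each is treated as a combination of real integrals. *)
Lemma is_CInt_scal c f a b l : is_CInt f a b l -> is_CInt (fun x => c * f x) a b (c * l).
Proof.
  intros H; pose proof (is_CInt_fst _ _ _ _ H) as H1; pose proof (is_CInt_snd _ _ _ _ H) as H2.
  apply is_CInt_pair.
  - apply @is_RInt_minus; apply @is_RInt_scal; assumption.
  - apply @is_RInt_plus; apply @is_RInt_scal; assumption.
Qed.

Lemma is_CInt_RtoC f a b l : is_RInt f a b l -> is_CInt (fun x => RtoC (f x)) a b (RtoC l).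
Proof.
  intros H; apply is_CInt_pair; [exact H|].
  evar_last; [exact (is_RInt_const a b 0%R)|]. unfold scal; simpl; unfold mult; simpl; ring.
Qed.

Lemma norm_C_R (z : C) : @norm R_AbsRing C_R_NormedModule z = Cmod z.
Proof.
  change (sqrt (Rabs (fst z) ^ 2 + Rabs (snd z) ^ 2) = Cmod z).
  unfold Cmod; now rewrite !pow2_abs.
Qed.

Lemma Cmod_CInt_le f g a b l m : (a <= b)%R ->
  (forall x, (a <= x <= b)%R -> (Cmod (f x) <= g x)%R) ->
  is_CInt f a b l -> is_RInt g a b m -> (Cmod l <= m)%R.
Proof.
  intros Hab H Hf Hg; rewrite <- norm_C_R.
  apply (norm_RInt_le (V := C_R_NormedModule) f g a b); try assumption.
  intros x Hx; rewrite norm_C_R; auto.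
Qed.

Lemma is_derive_C_continuous f t l : is_derive_C f t l -> continuous_C f t.
Proof.
  intros [H1 H2]; split; apply @ex_derive_continuous; eexists; eassumption.
Qed.

Lemma is_CInt_derive F f a b : (a <= b)%R ->
  (forall t, (a <= t <= b)%R -> is_derive_C F t (f t)) ->
  (forall t, (a <= t <= b)%R -> continuous_C f t) ->
  is_CInt f a b (F b - F a).
Proof.
  intros Hab HF Hf; apply is_CInt_pair.
  - apply (is_RInt_derive (fun x => Re (F x)) (fun x => Re (f x)));
      rewrite Rmin_left, Rmax_right by lra; intros x Hx; [now apply HF|now apply Hf].
  - apply (is_RInt_derive (fun x => Im (F x)) (fun x => Im (f x)));
      rewrite Rmin_left, Rmax_right by lra; intros x Hx; [now apply HF|now apply Hf].
Qed.

Definition CInt (f : R -> C) (a b : R) : C :=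
  (RInt (fun x => Re (f x)) a b, RInt (fun x => Im (f x)) a b).

Lemma CInt_correct f a b : (a <= b)%R ->
  (forall t, (a <= t <= b)%R -> continuous_C f t) -> is_CInt f a b (CInt f a b).
Proof.
  intros Hab Hf; apply is_CInt_pair; apply (RInt_correct (V := R_CompleteNormedModule));
  apply @ex_RInt_continuous; rewrite Rmin_left, Rmax_right by lra; intros x Hx; now apply Hf.
Qed.

Lemma CInt_unique f a b l : is_CInt f a b l -> CInt f a b = l.
Proof.
  intros H; apply C_ext; apply (is_RInt_unique (V := R_CompleteNormedModule));
  [now apply is_CInt_fst|now apply is_CInt_snd].
Qed.

Lemma is_CInt_unique f a b l l' : is_CInt f a b l -> is_CInt f a b l' -> l = l'.
Proof. intros H H'; rewrite <- (CInt_unique _ _ _ _ H); now apply CInt_unique. Qed.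

Lemma Re_le_Cmod (z : C) : (Re z <= Cmod z)%R.
Proof. eapply Rle_trans; [apply Rle_abs|apply re_le_Cmod]. Qed.

(** * Partial fractions of the tangent *)

Lemma Ci2 : Ci * Ci = -1.
Proof. apply C_ext; simpl; ring. Qed.

(** A form without division by [Ci], so that [field] leaves no condition on [Ci] behind. *)
Lemma Csin_alt z : Csin z = - (Ci / 2) * (Cexp (Ci * z) - Cexp (- (Ci * z))).
Proof.
  unfold Csin. transitivity (/ Ci * ((Cexp (Ci * z) - Cexp (- (Ci * z))) / 2)).
  - field; apply Ci_nz.
  - rewrite Ci_inv; field.
Qed.

Lemma Ccos_plus x y : Ccos (x + y) = Ccos x * Ccos y - Csin x * Csin y.
Proof.
  rewrite !Csin_alt; unfold Ccos.
  rewrite Cmult_plus_distr_l, Copp_plus_distr, !Cexp_plus.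
  set (u := Cexp (Ci * x)); set (u' := Cexp (- (Ci * x))).
  set (v := Cexp (Ci * y)); set (v' := Cexp (- (Ci * y))).
  (* [Ci] is an atom for [field]; its square is isolated in order to be rewritten to -1. *)
  replace (- (Ci / 2) * (u - u') * (- (Ci / 2) * (v - v')))
    with ((Ci * Ci) * ((u - u') * (v - v') / 4)) by field.
  rewrite Ci2; field.
Qed.

Lemma Csin_plus x y : Csin (x + y) = Csin x * Ccos y + Ccos x * Csin y.
Proof.
  rewrite !Csin_alt; unfold Ccos.
  rewrite Cmult_plus_distr_l, Copp_plus_distr, !Cexp_plus; field.
Qed.

Lemma Ccos_opp x : Ccos (- x) = Ccos x.
Proof.
  unfold Ccos; replace (Ci * - x) with (- (Ci * x)) by ring; replace (- - (Ci * x)) with (Ci * x) by ring; field.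
Qed.

Lemma Csin_opp x : Csin (- x) = - Csin x.
Proof.
  rewrite !Csin_alt; replace (Ci * - x) with (- (Ci * x)) by ring; replace (- - (Ci * x)) with (Ci * x) by ring; field.
Qed.

Lemma Ccos_0 : Ccos 0 = 1.
Proof. unfold Ccos; rewrite Cmult_0_r, Copp_0, Cexp_0; field. Qed.

Lemma Csin_0 : Csin 0 = 0.
Proof. rewrite Csin_alt, Cmult_0_r, Copp_0, Cexp_0; field. Qed.

Lemma Ccos_Ci (x : R) : Ccos (Ci * x) = cosh x.
Proof.
  unfold Ccos. replace (Ci * (Ci * x)) with (RtoC (- x)).
  - unfold Cexp, cosh; apply C_ext; simpl; rewrite ?Ropp_0, ?Ropp_involutive, ?cos_0, ?sin_0; field.
  - rewrite Cmult_assoc, Ci2, RtoC_opp; ring.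
Qed.

Lemma is_derive_C_lin (w : C) (t : R) : is_derive_C (fun x => w * RtoC x) t w.
Proof.
  eapply is_derive_C_eq.
  - apply is_derive_C_mult; [apply is_derive_C_const|apply is_derive_C_id].
  - cbv beta; ring.
Qed.

Lemma is_derive_C_Ccos w t : is_derive_C (fun x => Ccos (w * RtoC x)) t (- w * Csin (w * t)).
Proof.
  eapply is_derive_C_ext with (fun x => (/ 2) * (Cexp (Ci * w * RtoC x) + Cexp (- (Ci * w) * RtoC x))).
  - intros x; unfold Ccos. replace (- (Ci * w) * x) with (- (Ci * (w * x))) by ring.
    rewrite Cmult_assoc; field.
  - eapply is_derive_C_eq.
    + apply is_derive_C_mult; [apply is_derive_C_const|].
      apply is_derive_C_plus; apply is_derive_C_Cexp, is_derive_C_lin.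
    + rewrite Csin_alt. replace (- (Ci * w) * t) with (- (Ci * (w * t))) by ring.
      rewrite (Cmult_assoc Ci w t); field.
Qed.

Lemma is_derive_C_Csin w t : is_derive_C (fun x => Csin (w * RtoC x)) t (w * Ccos (w * t)).
Proof.
  eapply is_derive_C_ext with (fun x => - (Ci / 2) * (Cexp (Ci * w * RtoC x) - Cexp (- (Ci * w) * RtoC x))).
  - intros x; rewrite Csin_alt. replace (- (Ci * w) * x) with (- (Ci * (w * x))) by ring.
    rewrite Cmult_assoc; field.
  - eapply is_derive_C_eq.
    + apply is_derive_C_mult; [apply is_derive_C_const|].
      apply is_derive_C_minus; apply is_derive_C_Cexp, is_derive_C_lin.
    + unfold Ccos. replace (- (Ci * w) * t) with (- (Ci * (w * t))) by ring.
      rewrite (Cmult_assoc Ci w t).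
      set (u := Cexp (Ci * w * t)); set (v := Cexp _).
      transitivity (- (Ci * Ci) * (w * (u + v) / 2)); [field|rewrite Ci2; field].
Qed.

Lemma is_derive_C_pow f t l n :
  is_derive_C f t l -> is_derive_C (fun x => f x ^ S n) t (RtoC (INR n + 1) * f t ^ n * l).
Proof.
  intros H; induction n as [|n IH].
  - apply is_derive_C_ext with f; [intros x; ring|].
    eapply is_derive_C_eq; [exact H|]. simpl; rewrite Rplus_0_l; ring.
  - apply is_derive_C_ext with (fun x => f x * f x ^ S n); [reflexivity|].
    eapply is_derive_C_eq; [apply is_derive_C_mult; eassumption|].
    cbv beta; rewrite S_INR, !RtoC_plus, !Cpow_S; ring.
Qed.

Lemma is_derive_C_sin t : is_derive_C (fun x => RtoC (sin x)) t (RtoC (cos t)).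
Proof. apply is_derive_C_RtoC, is_derive_sin. Qed.

Lemma is_derive_C_cos t : is_derive_C (fun x => RtoC (cos x)) t (- RtoC (sin t)).
Proof. rewrite <- RtoC_opp; apply is_derive_C_RtoC, is_derive_cos. Qed.

Ltac derive_C :=
  repeat lazymatch goal with
  | |- is_derive_C (fun _ => _ + _) _ _ => apply is_derive_C_plus
  | |- is_derive_C (fun _ => _ - _) _ _ => apply is_derive_C_minus
  | |- is_derive_C (fun x => ?w * RtoC x) _ _ => apply is_derive_C_lin
  | |- is_derive_C (fun _ => _ * _) _ _ => apply is_derive_C_mult
  | |- is_derive_C (fun _ => _ / _) _ _ => apply is_derive_C_div
  | |- is_derive_C (fun _ => Cpow _ (S _)) _ _ => apply is_derive_C_pow
  | |- is_derive_C RtoC _ _ => apply is_derive_C_id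
  | |- is_derive_C (fun x => RtoC x) _ _ => apply is_derive_C_id
  | |- is_derive_C (fun _ => ?c) _ _ => apply is_derive_C_const
  | |- is_derive_C (fun x => Ccos (?w * RtoC x)) _ _ => apply is_derive_C_Ccos
  | |- is_derive_C (fun x => Csin (?w * RtoC x)) _ _ => apply is_derive_C_Csin
  | |- is_derive_C (fun x => RtoC (sin x)) _ _ => apply is_derive_C_sin
  | |- is_derive_C (fun x => RtoC (cos x)) _ _ => apply is_derive_C_cos
  | |- is_derive_C (fun _ => Cexp _) _ _ => apply is_derive_C_Cexp
  end.

Lemma ex_derive_C_pow f t n :
  (exists l, is_derive_C f t l) -> exists l, is_derive_C (fun x => f x ^ n) t l.
Proof.
  intros [l H]; destruct n as [|n].
  - exists 0; apply is_derive_C_ext with (fun _ => 1); [intros; simpl; ring|apply is_derive_C_const].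
  - eexists; apply is_derive_C_pow; exact H.
Qed.

(** * The integrals of cos(w t) cos^n t and their recursions *)

Definition cos_int (w : C) (n : nat) : C :=
  CInt (fun t => Ccos (w * t) * RtoC (cos t) ^ n) 0 (PI / 2).

(** Minus the derivative of [cos_int w n] in [w], introduced as an integral of its own: its
    recursion is proved directly and nothing is ever differentiated in [w]. *)
Definition tsin_int (w : C) (n : nat) : C :=
  CInt (fun t => RtoC t * Csin (w * t) * RtoC (cos t) ^ n) 0 (PI / 2).

Lemma PI2_ge_0 : (0 <= PI / 2)%R.
Proof. pose proof PI_RGT_0; lra. Qed.

Lemma cos_int_continuous w n t : continuous_C (fun t => Ccos (w * t) * RtoC (cos t) ^ n) t.
Proof.
  destruct (ex_derive_C_pow (fun x => RtoC (cos x)) t n) as [l H];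
    [eexists; apply is_derive_C_cos|].
  eapply is_derive_C_continuous, is_derive_C_mult; [apply is_derive_C_Ccos|exact H].
Qed.

Lemma tsin_int_continuous w n t :
  continuous_C (fun t => RtoC t * Csin (w * t) * RtoC (cos t) ^ n) t.
Proof.
  destruct (ex_derive_C_pow (fun x => RtoC (cos x)) t n) as [l H];
    [eexists; apply is_derive_C_cos|].
  eapply is_derive_C_continuous, is_derive_C_mult; [apply is_derive_C_mult|exact H].
  - apply is_derive_C_id.
  - apply is_derive_C_Csin.
Qed.

Lemma cos_int_correct w n :
  is_CInt (fun t => Ccos (w * t) * RtoC (cos t) ^ n) 0 (PI / 2) (cos_int w n).
Proof. apply CInt_correct; [apply PI2_ge_0|intros; apply cos_int_continuous]. Qed.

Lemma tsin_int_correct w n :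
  is_CInt (fun t => RtoC t * Csin (w * t) * RtoC (cos t) ^ n) 0 (PI / 2) (tsin_int w n).
Proof. apply CInt_correct; [apply PI2_ge_0|intros; apply tsin_int_continuous]. Qed.

Lemma continuous_C_plus f g t :
  continuous_C f t -> continuous_C g t -> continuous_C (fun x => f x + g x) t.
Proof. intros [] []; split; now apply @continuous_plus. Qed.

Lemma continuous_C_minus f g t :
  continuous_C f t -> continuous_C g t -> continuous_C (fun x => f x - g x) t.
Proof. intros [] []; split; now apply @continuous_minus. Qed.

Lemma continuous_C_const c t : continuous_C (fun _ => c) t.
Proof. eapply is_derive_C_continuous, is_derive_C_const. Qed.

Lemma continuous_C_mult f g t :
  continuous_C f t -> continuous_C g t -> continuous_C (fun x => f x * g x) t.
Proof.
  intros [] []; split; [apply @continuous_minus|apply @continuous_plus];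
  now apply (continuous_mult (K := R_AbsRing)).
Qed.

Ltac continuous_C_split :=
  repeat lazymatch goal with
  | |- continuous_C (fun _ => _ + _) _ => apply continuous_C_plus
  | |- continuous_C (fun _ => _ - _) _ => apply continuous_C_minus
  | |- continuous_C (fun x => Ccos _ * _) _ => apply cos_int_continuous
  | |- continuous_C (fun x => RtoC x * _ * _) _ => apply tsin_int_continuous
  | |- continuous_C (fun _ => ?c * _) _ => apply continuous_C_mult; [apply continuous_C_const|]
  end.

Lemma sin2_cos2_C (t : R) : RtoC (sin t) * RtoC (sin t) = 1 - RtoC (cos t) * RtoC (cos t).
Proof.
  rewrite <- !RtoC_mult, <- RtoC_minus; f_equal.
  pose proof (sin2_cos2 t); unfold Rsqr in *; lra.
Qed.

(** Two integrations by parts, condensed into one primitive [F]. It vanishes at both ends: at 0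
    because of the sines, at PI/2 because of the positive powers of the cosine. *)
Lemma cos_int_rec w n (N := RtoC (INR n + 2)) :
  (N ^ 2 - w ^ 2) * cos_int w (S (S n)) = N * (N - 1) * cos_int w n.
Proof.
  set (F := fun t : R => N * (Ccos (w * t) * RtoC (sin t) * RtoC (cos t) ^ S n)
    - w * (Csin (w * t) * RtoC (cos t) ^ S (S n))).
  assert (HF : F (PI / 2)%R - F 0%R = 0).
  { unfold F; rewrite sin_0, cos_PI2, !Cpow_S, !Cmult_0_r, ?Csin_0; ring. }
  apply Ceq_minus; rewrite <- HF.
  apply is_CInt_unique with (f := fun t : R =>
    (N ^ 2 - w ^ 2) * (Ccos (w * t) * RtoC (cos t) ^ S (S n))
    - N * (N - 1) * (Ccos (w * t) * RtoC (cos t) ^ n)) (a := 0%R) (b := (PI / 2)%R).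
  - apply is_CInt_minus; apply is_CInt_scal; apply cos_int_correct.
  - apply is_CInt_derive; [apply PI2_ge_0| |].
    + intros t _; eapply is_derive_C_eq.
      * unfold F; derive_C.
      * cbv beta. rewrite S_INR. unfold N. rewrite !Cpow_S, !RtoC_plus.
        set (c := RtoC (cos t)); set (s := RtoC (sin t)); set (m := RtoC (INR n)).
        apply Ceq_minus.
        transitivity ((m + 2) * (m + 1) * Ccos (w * t) * c ^ n * (1 - c * c - s * s)); [ring|].
        unfold s, c; rewrite sin2_cos2_C; ring.
    + intros t _; continuous_C_split.
Qed.

(* The [w]-derivative of [cos_int_rec]. *)
Lemma tsin_int_rec w n (N := RtoC (INR n + 2)) :
  (N ^ 2 - w ^ 2) * tsin_int w (S (S n)) + 2 * w * cos_int w (S (S n))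
  = N * (N - 1) * tsin_int w n.
Proof.
  (* Minus the [w]-derivative of the primitive used in [cos_int_rec]. *)
  set (F := fun t : R => w * (RtoC t * (Ccos (w * t) * RtoC (cos t) ^ S (S n)))
    + Csin (w * t) * RtoC (cos t) ^ S (S n)
    + N * (RtoC t * (Csin (w * t) * (RtoC (sin t) * RtoC (cos t) ^ S n)))).
  assert (HF : F (PI / 2)%R - F 0%R = 0).
  { unfold F; rewrite sin_0, cos_PI2, !Cpow_S, !Cmult_0_r, ?Csin_0; ring. }
  apply Ceq_minus; rewrite <- HF.
  apply is_CInt_unique with (f := fun t : R =>
    (N ^ 2 - w ^ 2) * (RtoC t * Csin (w * t) * RtoC (cos t) ^ S (S n))
    + 2 * w * (Ccos (w * t) * RtoC (cos t) ^ S (S n))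
    - N * (N - 1) * (RtoC t * Csin (w * t) * RtoC (cos t) ^ n)) (a := 0%R) (b := (PI / 2)%R).
  - apply is_CInt_minus; [apply is_CInt_plus|]; apply is_CInt_scal;
      [apply tsin_int_correct|apply cos_int_correct|apply tsin_int_correct].
  - apply is_CInt_derive; [apply PI2_ge_0| |].
    + intros t _; eapply is_derive_C_eq.
      * unfold F.
        derive_C.
      * cbv beta. rewrite S_INR. unfold N. rewrite !Cpow_S, !RtoC_plus.
        set (c := RtoC (cos t)); set (s := RtoC (sin t)); set (m := RtoC (INR n)).
        apply Ceq_minus.
        transitivity ((m + 2) * (m + 1) * RtoC t * Csin (w * t) * c ^ n * (1 - c * c - s * s)); [ring|].
        unfold s, c; rewrite sin2_cos2_C; ring.
    + intros t _; continuous_C_split.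
Qed.

(** The primitive of [cos_int_rec] taken at n = -1, that is N = 1. The power of the cosine that
    killed it at PI/2 is now the zeroth, and the boundary value left there is the denominator of the
    tangent. *)
Lemma cos_int_1 w : (1 - w ^ 2) * cos_int w 1 = Ccos (w * RtoC (PI / 2)).
Proof.
  set (F := fun t : R => Ccos (w * t) * RtoC (sin t) - w * (Csin (w * t) * RtoC (cos t))).
  replace (Ccos (w * RtoC (PI / 2))) with (F (PI / 2)%R - F 0%R).
  2: { unfold F; rewrite sin_PI2, cos_PI2, sin_0, !Cmult_0_r, ?Csin_0; ring. }
  apply is_CInt_unique with (f := fun t : R =>
    (1 - w ^ 2) * (Ccos (w * t) * RtoC (cos t) ^ 1)) (a := 0%R) (b := (PI / 2)%R).
  - apply is_CInt_scal; apply cos_int_correct.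
  - apply is_CInt_derive; [apply PI2_ge_0| |].
    + intros t _; eapply is_derive_C_eq.
      * unfold F.
        derive_C.
      * cbv beta; ring.
    + intros t _; apply continuous_C_mult; [apply continuous_C_const|apply cos_int_continuous].
Qed.

(** Minus the [w]-derivative of [cos_int_1]. The quotient of the two identities is where the tangent
    enters. *)
Lemma tsin_int_1 w :
  (1 - w ^ 2) * tsin_int w 1 + 2 * w * cos_int w 1 = RtoC (PI / 2) * Csin (w * RtoC (PI / 2)).
Proof.
  set (F := fun t : R => w * (RtoC t * (Ccos (w * t) * RtoC (cos t)))
    + Csin (w * t) * RtoC (cos t)
    + RtoC t * (Csin (w * t) * RtoC (sin t))).
  replace (RtoC (PI / 2) * Csin (w * RtoC (PI / 2))) with (F (PI / 2)%R - F 0%R).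
  2: { unfold F; rewrite sin_PI2, cos_PI2, sin_0, !Cmult_0_r, Csin_0; ring. }
  apply is_CInt_unique with (f := fun t : R =>
    (1 - w ^ 2) * (RtoC t * Csin (w * t) * RtoC (cos t) ^ 1)
    + 2 * w * (Ccos (w * t) * RtoC (cos t) ^ 1)) (a := 0%R) (b := (PI / 2)%R).
  - apply is_CInt_plus; apply is_CInt_scal; [apply tsin_int_correct|apply cos_int_correct].
  - apply is_CInt_derive; [apply PI2_ge_0| |].
    + intros t _; eapply is_derive_C_eq.
      * unfold F.
        derive_C.
      * cbv beta; ring.
    + intros t _; continuous_C_split.
Qed.

(** * Concentration of cos^n t at t = 0 and the size of the remainder *)

Definition wallis (n : nat) : R := RInt (fun t => cos t ^ n)%R 0 (PI / 2).

Lemma continuous_cos_pow n t : continuous (fun x => cos x ^ n)%R t.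
Proof.
  apply @ex_derive_continuous. apply ex_derive_pow. eexists; apply is_derive_cos.
Qed.

Lemma wallis_correct n : is_RInt (fun t => cos t ^ n)%R 0 (PI / 2) (wallis n).
Proof.
  apply (RInt_correct (V := R_CompleteNormedModule)), @ex_RInt_continuous.
  intros; apply continuous_cos_pow.
Qed.

Lemma wallis_pos n : (0 < wallis n)%R.
Proof.
  pose proof PI_RGT_0.
  apply RInt_gt_0; [lra| |intros; apply continuous_cos_pow].
  intros x Hx; apply pow_lt, cos_gt_0; lra.
Qed.

Lemma wallis_rec n : ((INR n + 2) * wallis (S (S n)) = (INR n + 1) * wallis n)%R.
Proof.
  set (F := fun t => (sin t * cos t ^ S n)%R).
  assert (H : is_RInt (fun t => (INR n + 2) * cos t ^ S (S n) - (INR n + 1) * cos t ^ n)%R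
    0 (PI / 2) (F (PI / 2) - F 0)%R).
  { apply (is_RInt_derive F).
    - intros t _. evar_last.
      + apply @is_derive_mult; [apply is_derive_sin|apply is_derive_pow, is_derive_cos|exact Rmult_comm].
      + simpl pred; rewrite S_INR. unfold plus, mult; simpl.
        pose proof (sin2_cos2 t) as E; unfold Rsqr in E.
        transitivity ((INR n + 2) * (cos t * (cos t * cos t ^ n))
          - (INR n + 1) * cos t ^ n * (sin t * sin t + cos t * cos t))%R; [ring|rewrite E; ring].
    - intros t _; apply @continuous_minus; apply @continuous_scal_r; apply continuous_cos_pow. }
  assert (H' : is_RInt (fun t => (INR n + 2) * cos t ^ S (S n) - (INR n + 1) * cos t ^ n)%R
    0 (PI / 2) ((INR n + 2) * wallis (S (S n)) - (INR n + 1) * wallis n)%R).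
  { apply @is_RInt_minus; apply @is_RInt_scal; apply wallis_correct. }
  apply (is_RInt_unique (V := R_CompleteNormedModule)) in H.
  apply (is_RInt_unique (V := R_CompleteNormedModule)) in H'.
  assert (F (PI / 2) - F 0 = 0)%R.
  { unfold F; rewrite sin_0, cos_PI2; simpl; ring. }
  simpl in *; lra.
Qed.

(** Under the weight cos^n t the mean of sin^2 t is exactly 1/(n+2). This concentration at t = 0 is
    the source of the O(1/n) remainder. *)
Lemma sin2_cos_pow_int n :
  is_RInt (fun t => sin t ^ 2 * cos t ^ n)%R 0 (PI / 2) (wallis n / (INR n + 2))%R.
Proof.
  pose proof (pos_INR n).
  replace (wallis n / (INR n + 2))%R with (wallis n - wallis (S (S n)))%R.
  - apply (is_RInt_ext (fun t => cos t ^ n - cos t ^ S (S n))%R).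
    + intros t _; pose proof (sin2_cos2 t) as E; unfold Rsqr in E; simpl.
      replace (sin t * (sin t * 1))%R with (1 - cos t * cos t)%R by lra; ring.
    + apply @is_RInt_minus; apply wallis_correct.
  - pose proof (wallis_rec n) as E.
    apply Rmult_eq_reg_l with (INR n + 2)%R; [|lra].
    rewrite Rmult_minus_distr_l, E; field; lra.
Qed.

(** On this range t <= 2, because PI <= 4, so t - t^3/6 >= t/3. The lemma trades t^2 for sin^2 t,
    whose weighted integral is known exactly. *)
Lemma le_3_sin t : (0 <= t <= PI / 2)%R -> (t <= 3 * sin t)%R.
Proof.
  intros [H1 H2]; pose proof PI_4.
  destruct (SIN t) as [H3 _]; [lra|pose proof PI_RGT_0; lra|].
  unfold sin_lb, sin_approx, sin_term in H3; simpl in H3.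
  assert (t * t <= 4)%R by nra.
  assert (t * (t * t) <= t * 4)%R by (apply Rmult_le_compat_l; lra).
  assert (t - t * (t * t) / 6 <= sin t)%R; [|lra].
  eapply Rle_trans; [|exact H3].
  (* The last two Taylor terms t^5/120 - t^7/5040 of the lower bound are together nonnegative, as
     t^2 <= 4. *)
  assert (0 <= t * (t * t) * ((t * t) * (1 / 120 - 1 / 5040 * (t * t))))%R.
  { repeat apply Rmult_le_pos; lra. }
  lra.
Qed.

Lemma Cmod_minus_le x y : (Cmod (x - y) <= Cmod x + Cmod y)%R.
Proof. unfold Cminus; rewrite <- (Cmod_opp y); apply Cmod_triangle. Qed.

Lemma Cmod_Ci : Cmod Ci = 1%R.
Proof.
  unfold Cmod, Ci; simpl; replace (0 * (0 * 1) + 1 * (1 * 1))%R with 1%R by ring; apply sqrt_1.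
Qed.

Lemma Cmod_Ccos_le z : (Cmod (Ccos z) <= exp (Cmod z))%R.
Proof.
  assert (H : forall u, Cmod u = Cmod z -> (Cmod (Cexp u) <= exp (Cmod z))%R).
  { intros u <-; rewrite Cmod_Cexp.
    destruct (Rle_lt_or_eq_dec _ _ (Re_le_Cmod u)) as [Hlt| ->]; [left; now apply exp_increasing|lra]. }
  unfold Ccos; rewrite Cmod_div by (intros E; apply RtoC_inj in E; lra).
  rewrite (Cmod_R 2), Rabs_pos_eq by lra.
  pose proof (Cmod_triangle (Cexp (Ci * z)) (Cexp (- (Ci * z)))).
  assert (E : Cmod (Ci * z) = Cmod z) by (rewrite Cmod_mult, Cmod_Ci; ring).
  pose proof (H _ E); rewrite <- Cmod_opp in E; pose proof (H _ E); lra.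
Qed.

(** The cosine is bounded on the compact range; integrating this bound from 0 controls the sine by a
    multiple of t, and integrating once more controls cos - 1 by a multiple of t^2. *)
Lemma Csin_Ccos_bounds w T : (0 <= T)%R ->
  exists M, (0 <= M)%R /\ forall t, (0 <= t <= T)%R ->
    (Cmod (Csin (w * t)) <= M * t)%R /\ (Cmod (Ccos (w * t) - 1) <= M * t ^ 2)%R.
Proof.
  intros HT; set (K := exp (Cmod w * T)).
  pose proof (Cmod_ge_0 w) as Hw. pose proof (exp_pos (Cmod w * T)) as HK; fold K in HK.
  assert (Hc : forall t, (0 <= t <= T)%R -> (Cmod (Ccos (w * t)) <= K)%R).
  { intros t Ht; eapply Rle_trans; [apply Cmod_Ccos_le|].
    rewrite Cmod_mult, Cmod_R, Rabs_pos_eq by lra. unfold K.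
    assert (Cmod w * t <= Cmod w * T)%R as [Hlt| ->] by (apply Rmult_le_compat_l; lra);
      [left; now apply exp_increasing|lra]. }
  set (M1 := (Cmod w * K)%R).
  assert (HM1 : (0 <= M1)%R) by (apply Rmult_le_pos; lra).
  assert (Hs : forall t, (0 <= t <= T)%R -> (Cmod (Csin (w * t)) <= M1 * t)%R).
  { intros t Ht.
    pose proof (Cmod_increment_le (fun t => Csin (w * t)) (fun t => w * Ccos (w * t))
      (fun t => M1 * t)%R (fun _ => M1) 0 t) as H.
    cbv beta in H; rewrite Cmult_0_r, Csin_0 in H.
    replace (Csin (w * t) - 0) with (Csin (w * t)) in H by ring.
    rewrite Rmult_0_r, Rminus_0_r in H; apply H; [lra| | |].
    - intros; apply is_derive_C_Csin.
    - intros; evar_last; [apply is_derive_scal, @is_derive_id|]. unfold one; simpl; ring.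
    - intros s Hs; rewrite Cmod_mult; apply Rmult_le_compat_l; [lra|apply Hc; lra]. }
  set (M2 := (Cmod w * M1)%R).
  assert (HM2 : (0 <= M2)%R) by (apply Rmult_le_pos; lra).
  exists (M1 + M2)%R; split; [lra|]; intros t Ht; split.
  - specialize (Hs t Ht); nra.
  - pose proof (Cmod_increment_le (fun t => Ccos (w * t)) (fun t => - w * Csin (w * t))
      (fun t => M2 / 2 * t ^ 2)%R (fun t => M2 * t)%R 0 t) as H.
    cbv beta in H; rewrite Cmult_0_r, Ccos_0 in H.
    assert (H' : (Cmod (Ccos (w * t) - 1) <= M2 / 2 * t ^ 2 - M2 / 2 * 0 ^ 2)%R).
    { apply H; [lra| | |].
      - intros; apply is_derive_C_Ccos.
      - intros; evar_last; [apply is_derive_scal, is_derive_pow, @is_derive_id|].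
        unfold one; simpl; field.
      - intros s Hs'; rewrite Cmod_mult, Cmod_opp; unfold M2; rewrite Rmult_assoc.
        apply Rmult_le_compat_l; [lra|apply Hs; lra]. }
    pose proof (pow2_ge_0 t); nra.
Qed.

(** Both t sin(w t) and cos(w t) - 1 are at most M t^2, hence at most 9 M sin^2 t, with 9 the square
    of the constant in [le_3_sin]. Integrated against cos^n t this gives 1/(n+2) times
    [wallis n]. *)
Lemma cos_int_bounds w : exists K, (0 <= K)%R /\ forall n,
  (Cmod (tsin_int w n) <= K * (wallis n / (INR n + 2)))%R /\
  (Cmod (cos_int w n - wallis n) <= K * (wallis n / (INR n + 2)))%R.
Proof.
  destruct (Csin_Ccos_bounds w (PI / 2) PI2_ge_0) as (M & HM & HB).
  exists (9 * M)%R; split; [lra|]; intros n.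
  assert (Ht2 : forall t, (0 <= t <= PI / 2)%R -> (0 <= t ^ 2 <= 9 * sin t ^ 2)%R).
  { intros t Ht; pose proof (le_3_sin t Ht); nra. }
  assert (Hc : forall t, (0 <= t <= PI / 2)%R -> (0 <= cos t ^ n)%R).
  { intros t Ht; apply pow_le, cos_ge_0; lra. }
  assert (HI : is_RInt (fun t => 9 * M * (sin t ^ 2 * cos t ^ n))%R 0 (PI / 2)
    (9 * M * (wallis n / (INR n + 2)))%R) by (apply @is_RInt_scal, sin2_cos_pow_int).
  split.
  - eapply Cmod_CInt_le; [apply PI2_ge_0| |apply tsin_int_correct|exact HI].
    intros t Ht; cbv beta; rewrite <- RtoC_pow, !Cmod_mult, !Cmod_R, (Rabs_pos_eq t),
      (Rabs_pos_eq (cos t ^ n)) by (try apply Hc; lra).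
    rewrite <- Rmult_assoc; apply Rmult_le_compat_r; [now apply Hc|].
    destruct (HB t Ht) as [Hs _]; specialize (Ht2 t Ht).
    assert (t * Cmod (Csin (w * t)) <= t * (M * t))%R by (apply Rmult_le_compat_l; lra). nra.
  - eapply Cmod_CInt_le; [apply PI2_ge_0| | |exact HI].
    2: { apply is_CInt_minus; [apply cos_int_correct|apply is_CInt_RtoC, wallis_correct]. }
    intros t Ht; cbv beta; rewrite <- RtoC_pow.
    replace (Ccos (w * t) * (cos t ^ n)%R - (cos t ^ n)%R)
      with ((Ccos (w * t) - 1) * (cos t ^ n)%R) by ring.
    rewrite !Cmod_mult, !Cmod_R, (Rabs_pos_eq (cos t ^ n)) by (now apply Hc).
    rewrite <- Rmult_assoc; apply Rmult_le_compat_r; [now apply Hc|].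
    destruct (HB t Ht) as [_ Hs]; specialize (Ht2 t Ht). nra.
Qed.

(** Once n is at least twice the constant of [cos_int_bounds], [cos_int w n] has modulus at least
    half of [wallis n], and the Wallis integrals cancel in the quotient. *)
Lemma tsin_div_cos_int_le w : exists K, (0 <= K)%R /\ forall n, (K <= INR n)%R ->
  (Cmod (tsin_int w n / cos_int w n) <= K / (INR n + 2))%R.
Proof.
  destruct (cos_int_bounds w) as (K & HK & HB); exists (2 * K)%R; split; [lra|].
  intros n Hn; destruct (HB n) as [H1 H2]; pose proof (wallis_pos n) as Hw.
  pose proof (pos_INR n) as HN.
  assert (H3 : (K * (wallis n / (INR n + 2)) <= wallis n / 2)%R).
  { replace (K * (wallis n / (INR n + 2)))%R with (wallis n * (K / (INR n + 2)))%R by (field; lra).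
    unfold Rdiv at 2; apply Rmult_le_compat_l; [lra|].
    apply Rmult_le_reg_r with (INR n + 2)%R; [lra|].
    replace (K / (INR n + 2) * (INR n + 2))%R with K by (field; lra); lra. }
  assert (H4 : (wallis n / 2 <= Cmod (cos_int w n))%R).
  { pose proof (Cmod_minus_le (cos_int w n) (cos_int w n - wallis n)) as H.
    replace (cos_int w n - (cos_int w n - wallis n)) with (RtoC (wallis n)) in H by ring.
    rewrite Cmod_R, Rabs_pos_eq in H by lra. lra. }
  rewrite Cmod_div by (apply Cmod_gt_0; lra).
  apply Rmult_le_reg_r with (Cmod (cos_int w n)); [lra|].
  replace (Cmod (tsin_int w n) / Cmod (cos_int w n) * Cmod (cos_int w n))%R
    with (Cmod (tsin_int w n)) by (field; lra).
  eapply Rle_trans; [exact H1|].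
  replace (K * (wallis n / (INR n + 2)))%R with (2 * K / (INR n + 2) * (wallis n / 2))%R by (field; lra).
  apply Rmult_le_compat_l; [|exact H4].
  apply Rdiv_le_0_compat; lra.
Qed.

(** Balls of [C_UniformSpace] are componentwise; this is the passage from estimates of the
    modulus. *)
Lemma filterlim_Cmod {T} (F : (T -> Prop) -> Prop) {FF : Filter F} (f : T -> C) (g : T -> R) (l : C) :
  F (fun x => (Cmod (f x - l) <= g x)%R) -> filterlim g F (locally 0%R) ->
  filterlim f F (locally (T := C_UniformSpace) l).
Proof.
  intros Hf Hg; apply filterlim_locally; intros eps.
  pose proof (proj1 (filterlim_locally g 0%R) Hg eps) as Hg'.
  generalize (filter_and _ _ Hf Hg'); apply filter_imp; intros x [H1 H2].
  assert (H3 : (g x < eps)%R).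
  { change (Rabs (g x - 0) < eps)%R in H2; apply Rabs_def2 in H2; lra. }
  split; [change (Rabs (Re (f x - l)) < eps)%R|change (Rabs (Im (f x - l)) < eps)%R].
  - eapply Rle_lt_trans; [apply re_le_Cmod|lra].
  - eapply Rle_lt_trans; [|apply Rle_lt_trans with (1 := H1), H3].
    pose proof (Rmax_Cmod (f x - l)); eapply Rle_trans; [apply Rmax_r|exact H].
Qed.

Definition odd_C (k : nat) : C := RtoC (2 * INR k + 1).

Lemma odd_C_0_sqr : odd_C 0 ^ 2 = 1.
Proof. unfold odd_C; simpl; rewrite Rmult_0_r, Rplus_0_l; ring. Qed.

Definition tan_term (w : C) (k : nat) : C := 2 * w / (odd_C k ^ 2 - w ^ 2).

Lemma RtoC_neq_0 (r : R) : r <> 0%R -> RtoC r <> 0.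
Proof. intros H E; apply H; now apply RtoC_inj in E. Qed.

Lemma Cmult_neq_0_l (a b : C) : a * b <> 0 -> a <> 0.
Proof. intros H ->; apply H; ring. Qed.
Lemma Cmult_neq_0_r (a b : C) : a * b <> 0 -> b <> 0.
Proof. intros H ->; apply H; ring. Qed.

Lemma INR_odd k : INR (2 * k + 1) = (2 * INR k + 1)%R.
Proof. rewrite plus_INR, mult_INR; simpl; ring. Qed.

(** Both facts travel together along [cos_int_rec]: its right side is nonzero by induction, so
    neither factor on the left vanishes. [cos_int_1] starts the induction. *)
Lemma odd_neq w : Ccos (w * RtoC (PI / 2)) <> 0 ->
  forall k, odd_C k ^ 2 - w ^ 2 <> 0 /\ cos_int w (2 * k + 1) <> 0.
Proof.
  intros H0; induction k as [|k [IH1 IH2]].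
  - pose proof (cos_int_1 w) as E. rewrite <- E in H0.
    rewrite odd_C_0_sqr.
    split; [now apply Cmult_neq_0_l in H0|now apply Cmult_neq_0_r in H0].
  - pose proof (cos_int_rec w (2 * k + 1)) as E; cbv zeta in E.
    replace (S (S (2 * k + 1))) with (2 * S k + 1)%nat in E by lia.
    replace (INR (2 * k + 1) + 2)%R with (2 * INR (S k) + 1)%R in E
      by (rewrite INR_odd, S_INR; ring).
    fold (odd_C (S k)) in E.
    assert (Hr : odd_C (S k) * (odd_C (S k) - 1) * cos_int w (2 * k + 1) <> 0).
    { pose proof (pos_INR (S k)); rewrite S_INR in *; unfold odd_C.
      apply Cmult_neq_0; [|exact IH2]. pose proof (pos_INR k).
      rewrite <- RtoC_minus; apply Cmult_neq_0; apply RtoC_neq_0; rewrite S_INR; lra. }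
    rewrite <- E in Hr.
    split; [now apply Cmult_neq_0_l in Hr|now apply Cmult_neq_0_r in Hr].
Qed.

(** Let T_n be the quotient of [tsin_int w n] by [cos_int w n]. Dividing [tsin_int_rec] by
    [cos_int_rec] gives T_n = T_(n+2) + 2w/(N^2 - w^2) with N = n + 2, so each step splits off one
    term. *)
Lemma tan_partial_sum w : Ccos (w * RtoC (PI / 2)) <> 0 -> forall k,
  RtoC (PI / 2) * Csin (w * RtoC (PI / 2)) / Ccos (w * RtoC (PI / 2))
  = sum_n (G := C_AbelianMonoid) (tan_term w) k + tsin_int w (2 * k + 1) / cos_int w (2 * k + 1).
Proof.
  intros H0; induction k as [|k IH].
  - rewrite sum_O. destruct (odd_neq w H0 0) as [H1 H2].
    unfold tan_term. rewrite odd_C_0_sqr in *.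
    rewrite <- (tsin_int_1 w), <- (cos_int_1 w). simpl (2 * 0 + 1)%nat in *.
    field; auto.
  - rewrite IH, sum_Sn. change (plus ?a ?b) with (Cplus a b).
    rewrite <- Cplus_assoc; f_equal.
    destruct (odd_neq w H0 (S k)) as [H1 H2]; destruct (odd_neq w H0 k) as [_ H3].
    pose proof (cos_int_rec w (2 * k + 1)) as E1; cbv zeta in E1.
    pose proof (tsin_int_rec w (2 * k + 1)) as E2; cbv zeta in E2.
    replace (S (S (2 * k + 1))) with (2 * S k + 1)%nat in * by lia.
    replace (INR (2 * k + 1) + 2)%R with (2 * INR (S k) + 1)%R in *
      by (rewrite INR_odd, S_INR; ring).
    fold (odd_C (S k)) in *. unfold tan_term.
    set (N := odd_C (S k)) in *.
    assert (Hr : (N ^ 2 - w ^ 2) * cos_int w (2 * S k + 1) <> 0) by (apply Cmult_neq_0; auto).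
    rewrite E1 in Hr; pose proof (Cmult_neq_0_l _ _ Hr) as HN.
    transitivity ((N * (N - 1) * tsin_int w (2 * k + 1)) / (N * (N - 1) * cos_int w (2 * k + 1))).
    + field; split; [exact H3|]. split; [now apply Cmult_neq_0_r in HN|now apply Cmult_neq_0_l in HN].
    + rewrite <- E1, <- E2; field; auto.
Qed.

Lemma tan_series w : Ccos (w * RtoC (PI / 2)) <> 0 ->
  filterlim (sum_n (G := C_AbelianMonoid) (tan_term w)) eventually
    (locally (T := C_UniformSpace)
      (RtoC (PI / 2) * Csin (w * RtoC (PI / 2)) / Ccos (w * RtoC (PI / 2)))).
Proof.
  intros H0; destruct (tsin_div_cos_int_le w) as (K & HK & HB).
  apply filterlim_Cmod with (g := fun k => (K * / (INR k + 1))%R).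
  - apply eventually_filter.
  - destruct (nfloor_ex K HK) as (m & _ & Hm).
    exists (S m); intros k Hk.
    rewrite (tan_partial_sum w H0 k).
    replace (_ - _) with (- (tsin_int w (2 * k + 1) / cos_int w (2 * k + 1))) by ring.
    rewrite Cmod_opp.
    apply le_INR in Hk; rewrite S_INR in Hk; pose proof (pos_INR k).
    eapply Rle_trans; [apply HB|]; rewrite INR_odd; [lra|].
    apply Rmult_le_compat_l; [lra|]. apply Rinv_le_contravar; lra.
  - replace 0%R with (K * 0)%R by ring.
    change (is_lim_seq (fun k => K * / (INR k + 1))%R (Rbar_mult K 0)).
    apply is_lim_seq_scal_l.
    apply is_lim_seq_ext with (fun n => / INR (S n))%R; [intros; now rewrite S_INR|].
    apply (is_lim_seq_incr_1 (fun n => / INR n)%R).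
    replace (Finite 0) with (Rbar_inv p_infty) by reflexivity.
    apply is_lim_seq_inv; [apply is_lim_seq_INR|discriminate].
Qed.

(** * The cosine transform of 1 / (x^2 + b^2) *)

(** For b = p + iq the real part x^2 + p^2 - q^2 may vanish, but then the imaginary part 2pq carries
    the estimate. The loss (p/|b|)^2 measures how close b is to the imaginary axis. *)
Lemma sqr_sum_le_Cmod (b : C) (x : R) :
  (Re b ^ 2 * (x ^ 2 + Re b ^ 2) <= 2 * Cmod b ^ 2 * Cmod (RtoC x ^ 2 + b ^ 2))%R.
Proof.
  pose proof (Cmod_ge_0 (RtoC x ^ 2 + b ^ 2)) as Hm.
  apply Rsqr_incr_0_var.
  2: { repeat apply Rmult_le_pos; try lra; rewrite ?Rmult_1_r; apply Cmod_ge_0. }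
  rewrite !Rsqr_pow2, !Rpow_mult_distr, !Cmod2_alt.
  replace (Re (RtoC x ^ 2 + b ^ 2)) with (x ^ 2 + Re b ^ 2 - Im b ^ 2)%R
    by (unfold Re, Im; simpl; ring).
  replace (Im (RtoC x ^ 2 + b ^ 2)) with (2 * Re b * Im b)%R by (unfold Re, Im; simpl; ring).
  set (r := (Re b ^ 2)%R); set (q := (Im b ^ 2)%R); set (y := (x ^ 2)%R).
  assert (0 <= r)%R by apply pow2_ge_0. assert (0 <= q)%R by apply pow2_ge_0.
  assert (0 <= y)%R by apply pow2_ge_0.
  replace ((2 * Re b * Im b) ^ 2)%R with (4 * (r * q))%R by (unfold r, q; ring).
  set (u := (y + r - q)%R).
  assert (Hu : (r * r * (u * u) <= (r + q) * (r + q) * (u * u))%R).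
  { apply Rmult_le_compat_r; [apply Rle_0_sqr|apply Rmult_le_compat; lra]. }
  assert (Hq : (r * r * (q * q) <= (r + q) * (r + q) * (r * q))%R).
  { replace ((r + q) * (r + q) * (r * q))%R
      with (r * r * (q * q) + (r * q) * (r * r + r * q + q * q))%R by ring.
    assert (0 <= r * q)%R by (apply Rmult_le_pos; lra).
    assert (0 <= r * q * (r * r + r * q + q * q))%R; [|lra].
    apply Rmult_le_pos; [lra|].
    pose proof (Rle_0_sqr r); pose proof (Rle_0_sqr q); unfold Rsqr in *; lra. }
  assert (Hs : (r * r * ((y + r) * (y + r)) <= r * r * (2 * (u * u) + 2 * (q * q)))%R).
  { apply Rmult_le_compat_l; [apply Rle_0_sqr|].
    replace (y + r)%R with (u + q)%R by (unfold u; ring).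
    pose proof (Rle_0_sqr (u - q)); unfold Rsqr in *; lra. }
  simpl; rewrite !Rmult_1_r. nra.
Qed.

Lemma sqr_sum_neq_0 (b : C) (x : R) : (0 < Re b)%R -> RtoC x ^ 2 + b ^ 2 <> 0.
Proof.
  intros Hb E; pose proof (sqr_sum_le_Cmod b x) as H; rewrite E, Cmod_0 in H.
  assert (0 < Re b ^ 2)%R by (apply pow_lt; lra). pose proof (pow2_ge_0 x). nra.
Qed.

Lemma Re_pos_neq_0 (b : C) : (0 < Re b)%R -> b <> 0.
Proof. intros H ->; simpl in H; lra. Qed.

(** The majorant 1/(1 + x^2) is chosen because its integrals are arctangents, bounded independently
    of the cutoff. *)
Lemma inv_sqr_sum_le (b : C) : (0 < Re b)%R ->
  exists L, (0 < L)%R /\ forall x, (Cmod (/ (RtoC x ^ 2 + b ^ 2)) <= L * / (1 + x ^ 2))%R.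
Proof.
  intros Hb; pose proof (proj1 (Cmod_gt_0 b) (Re_pos_neq_0 b Hb)) as Hm.
  set (r := (Re b ^ 2)%R). assert (Hr : (0 < r)%R) by (apply pow_lt; lra).
  exists (2 * Cmod b ^ 2 * (1 + / r) / r)%R.
  pose proof (Rinv_0_lt_compat r Hr) as Hri.
  assert (0 < Cmod b ^ 2)%R by (apply pow_lt; lra).
  split; [apply Rdiv_lt_0_compat; [apply Rmult_lt_0_compat|]; lra|].
  intros x; pose proof (sqr_sum_le_Cmod b x) as H0; fold r in H0.
  pose proof (proj1 (Cmod_gt_0 _) (sqr_sum_neq_0 b x Hb)) as Hd.
  pose proof (pow2_ge_0 x).
  rewrite Cmod_inv by (now apply sqr_sum_neq_0).
  apply Rmult_le_reg_r with (Cmod (RtoC x ^ 2 + b ^ 2)); [lra|].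
  rewrite Rinv_l by lra.
  apply Rmult_le_reg_r with (1 + x ^ 2)%R; [lra|].
  replace (2 * Cmod b ^ 2 * (1 + / r) / r * / (1 + x ^ 2) * Cmod (RtoC x ^ 2 + b ^ 2) * (1 + x ^ 2))%R
    with (2 * Cmod b ^ 2 * Cmod (RtoC x ^ 2 + b ^ 2) * ((1 + / r) / r))%R by (field; lra).
  apply Rle_trans with (r * (x ^ 2 + r) * ((1 + / r) / r))%R.
  - replace (r * (x ^ 2 + r) * ((1 + / r) / r))%R with (x ^ 2 + 1 + x ^ 2 * / r + r)%R by (field; lra).
    assert (0 <= x ^ 2 * / r)%R by (apply Rmult_le_pos; lra). lra.
  - apply Rmult_le_compat_r; [|exact H0].
    apply Rlt_le, Rdiv_lt_0_compat; lra.
Qed.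

Lemma ln_le_minus_1 y : (0 < y)%R -> (ln y <= y - 1)%R.
Proof.
  intros Hy; pose proof (exp_ineq1_le (ln y)) as H; rewrite exp_ln in H by assumption; lra.
Qed.

Lemma atan_le x : (0 <= x)%R -> (atan x <= x)%R.
Proof.
  intros Hx.
  assert (H : (Cmod (RtoC (atan x) - RtoC (atan 0)) <= x - 0)%R).
  { apply (Cmod_increment_le (fun t => RtoC (atan t)) (fun t => RtoC (/ (1 + t ^ 2))) (fun t => t) (fun _ => 1%R)).
    - exact Hx.
    - intros; apply is_derive_C_RtoC, is_derive_Reals, derivable_pt_lim_atan.
    - intros; apply @is_derive_id.
    - intros t _; rewrite Cmod_R; pose proof (pow2_ge_0 t).
      assert (0 < / (1 + t ^ 2))%R by (apply Rinv_0_lt_compat; lra).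
      rewrite Rabs_pos_eq by lra. rewrite <- Rinv_1. apply Rinv_le_contravar; lra. }
  rewrite atan_0, <- RtoC_minus, Cmod_R in H.
  pose proof (Rle_abs (atan x - 0)); lra.
Qed.

Lemma is_derive_C_sqr_sum b t : is_derive_C (fun x => RtoC x ^ 2 + b ^ 2) t (2 * t).
Proof.
  eapply is_derive_C_eq; [derive_C|]. simpl; cbv beta.
  rewrite RtoC_plus; ring.
Qed.

Lemma is_derive_C_inv_sqr_sum b t : (0 < Re b)%R ->
  is_derive_C (fun x => / (RtoC x ^ 2 + b ^ 2)) t (- (2 * t) / (RtoC t ^ 2 + b ^ 2) ^ 2).
Proof.
  intros Hb; apply (is_derive_C_inv (fun x => RtoC x ^ 2 + b ^ 2));
    [apply is_derive_C_sqr_sum|now apply sqr_sum_neq_0].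
Qed.

Lemma continuous_inv_sqr_sum b t : (0 < Re b)%R ->
  continuous_C (fun x => / (RtoC x ^ 2 + b ^ 2)) t.
Proof. intros Hb; eapply is_derive_C_continuous; now apply is_derive_C_inv_sqr_sum. Qed.

Lemma atan_tail v : (0 < v)%R -> (Rabs (atan v - PI / 2) <= / v)%R.
Proof.
  intros Hv; pose proof (atan_inv v Hv) as E; pose proof (Rinv_0_lt_compat v Hv).
  pose proof (atan_le (/ v) (Rlt_le _ _ H)).
  assert (0 <= atan (/ v))%R.
  { rewrite <- atan_0. apply Rlt_le, atan_increasing; lra. }
  rewrite Rabs_left1; lra.
Qed.

Lemma Cdiv_eq (z x y : C) : y <> 0 -> z * y = x -> z = x / y.
Proof. intros Hy <-; field; exact Hy. Qed.

(* The primitive is [(1/2b) (-i log (b + i x) + i log (b - i x))], split into real and imaginary parts. *)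
Lemma inv_sqr_sum_int (b : C) : (0 < Re b)%R ->
  exists K, forall X, (2 * Rabs (Im b) + 1 <= X)%R ->
    (Cmod (CInt (fun x => / (RtoC x ^ 2 + b ^ 2))%C 0 X - RtoC PI / (2 * b)) <= K * / X)%R.
Proof.
  intros Hb. set (p := Re b) in *; set (q := Im b).
  set (A := fun x => (atan ((x + q) / p) + atan ((x - q) / p))%R).
  set (B := fun x => (/ 2 * (ln (p ^ 2 + (x - q) ^ 2) - ln (p ^ 2 + (x + q) ^ 2)))%R).
  assert (Hp2 : (0 < p ^ 2)%R) by (apply pow_lt; lra).
  assert (Hb0 : b <> 0) by (now apply Re_pos_neq_0).
  assert (H2b : 2 * b <> 0) by (apply Cmult_neq_0; [apply RtoC_neq_0; lra|exact Hb0]).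
  assert (HI : forall X, (0 <= X)%R -> CInt (fun x => / (RtoC x ^ 2 + b ^ 2)) 0 X
    = / (2 * b) * (A X, B X)).
  { intros X HX; apply CInt_unique.
    apply is_CInt_eq with (/ (2 * b) * (A X, B X) - / (2 * b) * (A 0%R, B 0%R)).
    2: { replace (A 0%R, B 0%R) with (RtoC 0); [ring|].
         unfold A, B; apply C_ext; simpl.
         - replace ((0 - q) / p)%R with (- ((0 + q) / p))%R by (field; lra). rewrite atan_opp; ring.
         - replace ((0 - q) * ((0 - q) * 1))%R with ((0 + q) * ((0 + q) * 1))%R by ring; ring. }
    apply (is_CInt_derive (fun x => / (2 * b) * (A x, B x))); [lra| |intros; now apply continuous_inv_sqr_sum].
    intros t _.
    pose proof (pow2_ge_0 (t - q)); pose proof (pow2_ge_0 (t + q)).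
    set (d1 := (p ^ 2 + (t - q) ^ 2)%R) in *. set (d2 := (p ^ 2 + (t + q) ^ 2)%R) in *.
    eapply is_derive_C_eq.
    - apply is_derive_C_mult; [apply is_derive_C_const|].
      instantiate (1 := ((p / d1 + p / d2)%R, ((t - q) / d1 - (t + q) / d2)%R)).
      split; simpl.
      + unfold A; auto_derive; [exact I|].
        assert (1 + ((t + q) * / p) * ((t + q) * / p * 1) = d2 / p ^ 2)%R as -> by (unfold d2; field; lra).
        assert (1 + ((t + - q) * / p) * ((t + - q) * / p * 1) = d1 / p ^ 2)%R as -> by (unfold d1; field; lra).
        unfold d1, d2 in *; field; simpl in *; lra.
      + unfold B; auto_derive; [unfold d1, d2 in *; simpl in *; lra|].
        unfold d1, d2 in *; field; simpl in *; lra.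
    - cbv beta. rewrite Cmult_0_l, Cplus_0_l.
      pose proof (sqr_sum_neq_0 b t Hb) as Hd.
      transitivity (/ (2 * b) * (2 * b / (RtoC t ^ 2 + b ^ 2))); [|field; auto].
      f_equal.
      apply Cdiv_eq; [exact Hd|].
      assert (Eb : b = (p, q)) by (apply C_ext; reflexivity).
      rewrite Eb. unfold d1, d2 in *.
      apply C_ext; simpl; field; simpl in *; lra. }
  exists ((4 * p + 16 * Rabs q) * Cmod (/ (2 * b)))%R; intros X HX.
  pose proof (Rabs_pos q) as Hq; pose proof (Rle_abs q) as Hq1.
  pose proof (Rle_abs (- q)) as Hq2; rewrite Rabs_Ropp in Hq2.
  rewrite HI by lra.
  replace (/ (2 * b) * (A X, B X) - PI / (2 * b))
    with (/ (2 * b) * ((A X - PI)%R + Ci * RtoC (B X))).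
  2: { replace ((A X, B X) : C) with (RtoC (A X) + Ci * RtoC (B X)).
       - rewrite RtoC_minus; field; exact Hb0.
       - apply C_ext; simpl; ring. }
  rewrite Cmod_mult, (Rmult_comm _ (Cmod (/ _))), Rmult_assoc.
  apply Rmult_le_compat_l; [apply Cmod_ge_0|].
  eapply Rle_trans; [apply Cmod_triangle|].
  rewrite Cmod_mult, !Cmod_R.
  rewrite Cmod_Ci.
  rewrite Rmult_1_l, Rmult_plus_distr_r.
  assert (HX0 : (0 < / X)%R) by (apply Rinv_0_lt_compat; lra).
  (* Used at y = X + q and y = X - q, both at least X/2 since X >= 2|q| + 1. *)
  assert (Hinv : forall y, (X / 2 <= y)%R -> (/ y <= 2 * / X)%R).
  { intros y Hy; replace (2 * / X)%R with (/ (X / 2))%R by (field; lra).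
    apply Rinv_le_contravar; lra. }
  apply Rplus_le_compat.
  - unfold A.
    pose proof (atan_tail ((X + q) / p)) as H1. pose proof (atan_tail ((X - q) / p)) as H2.
    replace (/ ((X + q) / p))%R with (p * / (X + q))%R in H1 by (field; lra).
    replace (/ ((X - q) / p))%R with (p * / (X - q))%R in H2 by (field; lra).
    pose proof (Hinv (X + q)%R) as H3. pose proof (Hinv (X - q)%R) as H4.
    replace (atan ((X + q) / p) + atan ((X - q) / p) - PI)%R
      with ((atan ((X + q) / p) - PI / 2) + (atan ((X - q) / p) - PI / 2))%R by field.
    eapply Rle_trans; [apply Rabs_triang|].
    assert (Rabs (atan ((X + q) / p) - PI / 2) <= p * / (X + q))%R
      by (apply H1, Rdiv_lt_0_compat; lra).
    assert (Rabs (atan ((X - q) / p) - PI / 2) <= p * / (X - q))%R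
      by (apply H2, Rdiv_lt_0_compat; lra).
    assert (p * / (X + q) <= p * (2 * / X))%R by (apply Rmult_le_compat_l; lra).
    assert (p * / (X - q) <= p * (2 * / X))%R by (apply Rmult_le_compat_l; lra).
    lra.
  (* [B] changes sign with [q], so the one-sided bound from ln y <= y - 1, taken at [s = q] and at
     [s = - q], controls its absolute value. *)
  - assert (Hln : forall s, (Rabs s <= Rabs q)%R ->
      (/ 2 * (ln (p ^ 2 + (X - s) ^ 2) - ln (p ^ 2 + (X + s) ^ 2)) <= 16 * Rabs q * / X)%R).
    { intros s Hs. pose proof (Rle_abs s) as Hs1.
      pose proof (Rle_abs (- s)) as Hs2; rewrite Rabs_Ropp in Hs2.
      pose proof (pow2_ge_0 (X - s)); pose proof (pow2_ge_0 (X + s)).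
      rewrite <- ln_div by lra.
      eapply Rle_trans; [apply Rmult_le_compat_l; [lra|apply ln_le_minus_1, Rdiv_lt_0_compat; lra]|].
      replace (/ 2 * ((p ^ 2 + (X - s) ^ 2) / (p ^ 2 + (X + s) ^ 2) - 1))%R
        with (- s * (2 * X * / (p ^ 2 + (X + s) ^ 2)))%R by (field; lra).
      assert (Hi : (/ (p ^ 2 + (X + s) ^ 2) <= 4 * / X * / X)%R).
      { replace (4 * / X * / X)%R with (/ (X / 2 * (X / 2)))%R by (field; lra).
        apply Rinv_le_contravar; nra. }
      pose proof (Rinv_0_lt_compat (p ^ 2 + (X + s) ^ 2)).
      assert (H5 : (2 * X * / (p ^ 2 + (X + s) ^ 2) <= 2 * X * (4 * / X * / X))%R)
        by (apply Rmult_le_compat_l; lra).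
      replace (2 * X * (4 * / X * / X))%R with (8 * / X)%R in H5 by (field; lra).
      assert (0 <= 2 * X * / (p ^ 2 + (X + s) ^ 2))%R by (apply Rmult_le_pos; lra).
      apply Rle_trans with (Rabs q * (8 * / X))%R; [|nra].
      apply Rle_trans with (Rabs q * (2 * X * / (p ^ 2 + (X + s) ^ 2)))%R; [|nra].
      apply Rmult_le_compat_r; lra. }
    apply Rabs_le; unfold B; split.
    + pose proof (Hln (- q)%R) as H; rewrite Rabs_Ropp in H.
      replace (X - - q)%R with (X + q)%R in H by ring.
      replace (X + - q)%R with (X - q)%R in H by ring.
      specialize (H (Rle_refl _)); lra.
    + apply Hln; lra.
Qed.

(** * Truncated cosine integrals as functions of the frequency *)

Lemma is_derive_RInt_scaled (phi psi g : R -> R) (X u : R) :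
  (forall v, is_derive phi v (psi v)) -> (forall v, continuous psi v) ->
  (forall x, continuous g x) ->
  is_derive (fun u => RInt (fun x => phi (u * x) * g x) 0 X)%R u
    (RInt (fun x => (x * psi (u * x)) * g x) 0 X)%R.
Proof.
  intros Hphi Hpsi Hg.
  assert (HD : forall v x, is_derive (fun u => phi (u * x) * g x)%R v (x * psi (v * x) * g x)%R).
  { intros v x; evar_last.
    - apply (is_derive_scal_l (fun u => phi (u * x)%R) v (x * psi (v * x))%R (g x)).
      apply (is_derive_comp phi (fun u => u * x)%R); [apply Hphi|].
      evar_last; [apply @is_derive_scal_l, @is_derive_id|].
      unfold scal, one; simpl; unfold mult; simpl; ring.
    - reflexivity. }
  rewrite <- (RInt_ext (fun x => Derive (fun u => phi (u * x) * g x)%R u)).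
  2: { intros x _; apply is_derive_unique, HD. }
  apply is_derive_RInt_param.
  - apply filter_forall; intros v x _; eexists; apply HD.
  - intros x _. apply continuity_2d_pt_ext with (fun v x => x * psi (v * x) * g x)%R.
    { intros v y; symmetry; apply is_derive_unique, HD. }
    apply continuity_2d_pt_mult; [apply continuity_2d_pt_mult|].
    + apply continuity_2d_pt_id2.
    + apply continuity_1d_2d_pt_comp; [apply continuity_pt_filterlim, Hpsi|].
      apply continuity_2d_pt_mult; [apply continuity_2d_pt_id1|apply continuity_2d_pt_id2].
    + apply (continuity_1d_2d_pt_comp g (fun _ y => y)); [apply continuity_pt_filterlim, Hg|apply continuity_2d_pt_id2].
  - apply filter_forall; intros v; apply @ex_RInt_continuous; intros x _.
    apply (continuous_mult (K := R_AbsRing)); [|apply Hg].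
    apply (continuous_comp (fun x => v * x)%R phi).
    + apply (continuous_mult (K := R_AbsRing)); [apply continuous_const|apply continuous_id].
    + apply @ex_derive_continuous; eexists; apply Hphi.
Qed.

(* The extensionality lemmas leave equations at the carrier of a canonical structure, which [ring] does not recognise. *)
Ltac eq_R := match goal with |- @eq _ ?x ?y => change (@eq R x y) end.
Ltac eq_C := match goal with |- @eq _ ?x ?y => change (@eq C x y) end.

Lemma is_derive_C_CInt_scaled (phi psi : R -> R) (g : R -> C) (X u : R) :
  (forall v, is_derive phi v (psi v)) -> (forall v, continuous psi v) ->
  (forall x, continuous_C g x) ->
  is_derive_C (fun u => CInt (fun x => RtoC (phi (u * x)%R) * g x) 0 X) u
    (CInt (fun x => RtoC (x * psi (u * x))%R * g x) 0 X).
Proof.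
  intros Hphi Hpsi Hg.
  split; simpl.
  - rewrite (RInt_ext _ (fun x => (x * psi (u * x)) * Re (g x))%R).
    2: { intros; unfold Re; eq_R; ring. }
    apply is_derive_ext with (fun u => RInt (fun x => phi (u * x) * Re (g x)) 0 X)%R.
    + intros v; apply RInt_ext; intros; unfold Re; eq_R; ring.
    + apply is_derive_RInt_scaled; try assumption; intros; apply Hg.
  - rewrite (RInt_ext _ (fun x => (x * psi (u * x)) * Im (g x))%R).
    2: { intros; unfold Im; eq_R; ring. }
    apply is_derive_ext with (fun u => RInt (fun x => phi (u * x) * Im (g x)) 0 X)%R.
    + intros v; apply RInt_ext; intros; unfold Im; eq_R; ring.
    + apply is_derive_RInt_scaled; try assumption; intros; apply Hg.
Qed.

Lemma is_derive_C_exp_lin (c : C) t : is_derive_C (fun x => Cexp (c * RtoC x)) t (c * Cexp (c * t)).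
Proof. apply is_derive_C_Cexp, is_derive_C_lin. Qed.

Lemma Re_scal_R (b : C) (t : R) : Re (b * t) = (Re b * t)%R.
Proof. unfold Re; simpl; ring. Qed.

Lemma is_derive_exp_lin (r c t : R) : is_derive (fun x => c * exp (r * x))%R t (c * (r * exp (r * t)))%R.
Proof. auto_derive; [exact I|ring]. Qed.

(* A solution of [E' = b E + e], [Re b > 0], that stays bounded cannot have an [exp (b t)] component. *)
Lemma bounded_ode_small (b : C) (E e : R -> C) (d eta B : R) :
  (0 < Re b)%R -> (0 <= d)%R ->
  (forall t, (d <= t)%R -> is_derive_C E t (b * E t + e t)) ->
  (forall t, (d <= t)%R -> (Cmod (e t) <= eta)%R) ->
  (forall t, (d <= t)%R -> (Cmod (E t) <= B)%R) ->
  forall t, (d <= t)%R -> (Cmod (E t) <= eta / Re b)%R.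
Proof.
  intros Hb Hd HE He HB t Ht; set (r := Re b) in *.
  (* Integrating factor: [G] varies only through [e]. Integrating from t up to a far T, where [G] is
     small because [E] is bounded, gives the estimate at t. *)
  set (G := fun t => Cexp (- b * RtoC t) * E t).
  assert (HG : forall s, Cmod (G s) = (exp (- r * s) * Cmod (E s))%R).
  { intros s; unfold G; rewrite Cmod_mult, Cmod_Cexp, Re_scal_R; reflexivity. }
  assert (HdG : forall s, (d <= s)%R -> is_derive_C G s (Cexp (- b * s) * e s)).
  { intros s Hs; eapply is_derive_C_eq.
    - apply is_derive_C_mult; [apply is_derive_C_exp_lin|now apply HE].
    - cbv beta; ring. }
  assert (Hinc : forall T, (t <= T)%R -> (Cmod (G t) <= eta / r * exp (- r * t) + exp (- r * T) * B)%R).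
  { intros T HT.
    assert (H : (Cmod (G T - G t) <= - eta / r * exp (- r * T) - - eta / r * exp (- r * t))%R).
    { apply (Cmod_increment_le G (fun s => Cexp (- b * s) * e s) (fun s => - eta / r * exp (- r * s))%R
        (fun s => exp (- r * s) * eta)%R); [exact HT| | |].
      - intros; apply HdG; lra.
      - intros s _; evar_last; [apply is_derive_exp_lin|]. field; lra.
      - intros s Hs; rewrite Cmod_mult, Cmod_Cexp, Re_scal_R.
        apply Rmult_le_compat; [apply Rlt_le, exp_pos|apply Cmod_ge_0|right; reflexivity|apply He; lra]. }
    pose proof (Cmod_minus_le (G T) (G T - G t)) as H1.
    replace (G T - (G T - G t)) with (G t) in H1 by ring.
    assert (H2 : (Cmod (G T) <= exp (- r * T) * B)%R).
    { rewrite HG; apply Rmult_le_compat_l; [apply Rlt_le, exp_pos|apply HB; lra]. }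
    assert (0 <= eta)%R by (eapply Rle_trans; [apply Cmod_ge_0|apply (He t Ht)]).
    assert (0 <= eta / r * exp (- r * T))%R.
    { apply Rmult_le_pos; [apply Rdiv_le_0_compat; lra|apply Rlt_le, exp_pos]. }
    replace (- eta / r)%R with (- (eta / r))%R in H by (field; lra). lra. }
  assert (Hfin : (Cmod (G t) <= eta / r * exp (- r * t))%R).
  { apply le_epsilon; intros eps Heps.
    assert (HB0 : (0 <= B)%R) by (eapply Rle_trans; [apply Cmod_ge_0|apply (HB t Ht)]).
    (* Then r T >= B/eps, and exp(r T) >= 1 + r T pushes exp(- r T) B below eps. *)
    set (T := Rmax t (B / (r * eps))%R).
    eapply Rle_trans; [apply (Hinc T), Rmax_l|]. apply Rplus_le_compat_l.
    replace (- r * T)%R with (- (r * T))%R by ring. rewrite exp_Ropp.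
    assert (H3 : (B / eps <= r * T)%R).
    { replace (B / eps)%R with (r * (B / (r * eps)))%R by (field; lra).
      apply Rmult_le_compat_l; [lra|apply Rmax_r]. }
    pose proof (exp_ineq1_le (r * T)) as H4. pose proof (exp_pos (r * T)) as H5.
    apply Rmult_le_reg_l with (exp (r * T)); [exact H5|].
    replace (exp (r * T) * (/ exp (r * T) * B))%R with B by (field; lra).
    replace B with (B / eps * eps)%R at 1 by (field; lra).
    apply Rmult_le_compat_r; lra. }
  rewrite HG in Hfin. pose proof (exp_pos (- r * t)).
  apply Rmult_le_reg_l with (exp (- r * t)); [lra|]. lra.
Qed.

Lemma CInt_ext f g a b : (forall x, f x = g x) -> CInt f a b = CInt g a b.
Proof.
  intros H; unfold CInt; f_equal; apply RInt_ext; intros x _; now rewrite H.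
Qed.

Lemma continuous_C_RtoC f t : continuous f t -> continuous_C (fun x => RtoC (f x)) t.
Proof. intros H; split; [exact H|apply continuous_const]. Qed.

Lemma continuous_cos_scaled u x : continuous (fun x => cos (u * x)) x.
Proof. apply @ex_derive_continuous; auto_derive; exact I. Qed.

Lemma continuous_sin_scaled u x : continuous (fun x => - sin (u * x))%R x.
Proof. apply @ex_derive_continuous; auto_derive; exact I. Qed.

Definition cos_trunc (b : C) (X u : R) : C :=
  CInt (fun x => RtoC (cos (u * x)) * / (RtoC x ^ 2 + b ^ 2)) 0 X.

Definition sin_trunc (b : C) (X u : R) : C :=
  CInt (fun x => RtoC (- sin (u * x)) * (RtoC x * / (RtoC x ^ 2 + b ^ 2))) 0 X.

Lemma continuous_x_inv_sqr_sum b (Hb : (0 < Re b)%R) t : continuous_C (fun x => RtoC x * / (RtoC x ^ 2 + b ^ 2)) t.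
Proof.
  apply continuous_C_mult; [apply continuous_C_RtoC, continuous_id|now apply continuous_inv_sqr_sum].
Qed.

Lemma cos_trunc_correct b (Hb : (0 < Re b)%R) X u : (0 <= X)%R ->
  is_CInt (fun x => RtoC (cos (u * x)) * / (RtoC x ^ 2 + b ^ 2)) 0 X (cos_trunc b X u).
Proof.
  intros HX; apply CInt_correct; [exact HX|]; intros t _.
  apply continuous_C_mult; [apply continuous_C_RtoC, continuous_cos_scaled|].
  now apply continuous_inv_sqr_sum.
Qed.

Lemma sin_trunc_correct b (Hb : (0 < Re b)%R) X u : (0 <= X)%R ->
  is_CInt (fun x => RtoC (- sin (u * x)) * (RtoC x * / (RtoC x ^ 2 + b ^ 2))) 0 X (sin_trunc b X u).
Proof.
  intros HX; apply CInt_correct; [exact HX|]; intros t _.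
  apply continuous_C_mult; [apply continuous_C_RtoC, continuous_sin_scaled|].
  apply (continuous_x_inv_sqr_sum b Hb).
Qed.

Lemma is_derive_C_cos_trunc b (Hb : (0 < Re b)%R) X u : is_derive_C (cos_trunc b X) u (sin_trunc b X u).
Proof.
  eapply is_derive_C_eq.
  - apply (is_derive_C_CInt_scaled cos (fun v => - sin v)%R (fun x => / (RtoC x ^ 2 + b ^ 2))).
    + apply is_derive_cos.
    + intros v; apply @ex_derive_continuous; auto_derive; exact I.
    + intros; now apply continuous_inv_sqr_sum.
  - apply CInt_ext; intros x; rewrite RtoC_mult; ring.
Qed.

Lemma cos_scaled_int X u : u <> 0%R -> is_RInt (fun x => cos (u * x)) 0 X (sin (u * X) / u)%R.
Proof.
  intros Hu. replace (sin (u * X) / u)%R with (sin (u * X) / u - sin (u * 0) / u)%R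
    by (rewrite Rmult_0_r, sin_0; field; exact Hu).
  apply (is_RInt_derive (fun x => sin (u * x) / u)%R).
  - intros x _; auto_derive; [exact I|field; exact Hu].
  - intros x _; apply continuous_cos_scaled.
Qed.

(** x^2/(x^2 + b^2) = 1 - b^2/(x^2 + b^2): the second part returns the cosine integral, and the
    constant 1 integrates to the boundary term. *)
Lemma is_derive_C_sin_trunc b (Hb : (0 < Re b)%R) X u : (0 <= X)%R -> u <> 0%R ->
  is_derive_C (sin_trunc b X) u (b ^ 2 * cos_trunc b X u - RtoC (sin (u * X) / u)).
Proof.
  intros HX Hu; eapply is_derive_C_eq.
  - apply (is_derive_C_CInt_scaled (fun v => - sin v)%R (fun v => - cos v)%R
      (fun x => RtoC x * / (RtoC x ^ 2 + b ^ 2))).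
    + intros v; auto_derive; [exact I|ring].
    + intros v; apply @ex_derive_continuous; auto_derive; exact I.
    + apply (continuous_x_inv_sqr_sum b Hb).
  - apply CInt_unique.
    apply is_CInt_ext with (fun x => b ^ 2 * (RtoC (cos (u * x)) * / (RtoC x ^ 2 + b ^ 2)) - RtoC (cos (u * x))).
    + exact HX.
    + intros x _; rewrite RtoC_mult, RtoC_opp.
      pose proof (sqr_sum_neq_0 b x Hb); field; assumption.
    + apply is_CInt_minus; [apply is_CInt_scal, cos_trunc_correct; assumption|].
      apply is_CInt_RtoC, cos_scaled_int, Hu.
Qed.

(** A crude bound growing with [X] is enough: it only feeds [bounded_ode_small], whose conclusion
    does not involve [B]. *)
Lemma trunc_bounded b (Hb : (0 < Re b)%R) X : (0 <= X)%R -> exists B, forall u,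
  (Cmod (cos_trunc b X u) <= B)%R /\ (Cmod (sin_trunc b X u) <= B)%R.
Proof.
  intros HX; destruct (inv_sqr_sum_le b Hb) as (L & HL & HD).
  assert (HD' : forall x, (Cmod (/ (RtoC x ^ 2 + b ^ 2)) <= L)%R).
  { intros x; eapply Rle_trans; [apply HD|]. pose proof (pow2_ge_0 x).
    assert (/ (1 + x ^ 2) <= / 1)%R as H1 by (apply Rinv_le_contravar; lra).
    rewrite Rinv_1 in H1; apply Rle_trans with (L * 1)%R; [apply Rmult_le_compat_l|]; lra. }
  assert (Hc : forall c, is_RInt (fun _ => c) 0 X (X * c)%R).
  { intros c; evar_last; [apply @is_RInt_const|]. unfold scal; simpl; unfold mult; simpl; ring. }
  exists (X * L + X * (X * L))%R; intros u.
  assert (0 <= X * L)%R by (apply Rmult_le_pos; lra).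
  assert (0 <= X * (X * L))%R by (apply Rmult_le_pos; lra).
  split.
  - apply Rle_trans with (X * L)%R; [|lra].
    eapply Cmod_CInt_le; [exact HX| |now apply cos_trunc_correct|apply Hc].
    intros x _; cbv beta; rewrite Cmod_mult, Cmod_R.
    assert (Rabs (cos (u * x)) <= 1)%R by (apply Rabs_le; pose proof (COS_bound (u * x)); lra).
    pose proof (Rabs_pos (cos (u * x))).
    rewrite <- (Rmult_1_l L); apply Rmult_le_compat; try assumption; [apply Cmod_ge_0|apply HD'].
  - apply Rle_trans with (X * (X * L))%R; [|lra].
    eapply Cmod_CInt_le; [exact HX| |now apply sin_trunc_correct|apply Hc].
    intros x Hx; cbv beta; rewrite !Cmod_mult, !Cmod_R, (Rabs_pos_eq x) by lra.
    assert (Rabs (- sin (u * x)) <= 1)%R by (apply Rabs_le; pose proof (SIN_bound (u * x)); lra).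
    pose proof (Rabs_pos (- sin (u * x))).
    pose proof (Cmod_ge_0 (/ (RtoC x ^ 2 + b ^ 2))).
    rewrite <- (Rmult_1_l (X * L)); apply Rmult_le_compat; try assumption.
    + apply Rmult_le_pos; lra.
    + apply Rmult_le_compat; try lra; apply HD'.
Qed.

Lemma cos_trunc_shift b (Hb : (0 < Re b)%R) d : (0 < d)%R -> exists K, forall a X, (d <= a)%R -> (0 < X)%R ->
  (Cmod (cos_trunc b X a - Cexp (- b * RtoC (a - d)) * cos_trunc b X d) <= K * / X)%R.
Proof.
  intros Hd; set (r := Re b) in *.
  set (k := ((Cmod b / d + / d ^ 2) / r + / d)%R).
  exists (k / r)%R; intros a X Ha HX.
  pose proof (Rinv_0_lt_compat X HX) as HXi.
  assert (Hd2 : (0 < d ^ 2)%R) by (apply pow_lt; lra).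
  set (Q := fun u => b * cos_trunc b X u + sin_trunc b X u).
  (* An integration by parts in u: cos(u X)/(u X) has derivative - sin(u X)/u - cos(u X)/(u^2 X).
     Subtracting it from [Q] replaces the forcing sin(u X)/u, which is not small, by terms of size
     1/X. In [k], the summand 1/d pays for this correction. *)
  set (E := fun u => Q u - RtoC (cos (u * X) / (u * X))).
  assert (Habs : forall c D, (-1 <= c <= 1)%R -> (0 < D)%R -> (Rabs (c / D) <= / D)%R).
  { intros c D Hc HD; unfold Rdiv; rewrite Rabs_mult.
    pose proof (Rinv_0_lt_compat D HD). rewrite (Rabs_pos_eq (/ D)) by lra.
    rewrite <- (Rmult_1_l (/ D)) at 2; apply Rmult_le_compat_r; [lra|apply Rabs_le; lra]. }
  assert (HinvD : forall u, (d <= u)%R -> (/ (u * X) <= / d * / X)%R).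
  { intros u Hu; rewrite <- Rinv_mult; apply Rinv_le_contravar; nra. }
  assert (HE : forall u, (d <= u)%R -> (Cmod (E u) <= (Cmod b / d + / d ^ 2) * / X / r)%R).
  { destruct (trunc_bounded b Hb X (Rlt_le _ _ HX)) as (B & HB).
    apply bounded_ode_small with (b := b) (e := fun u =>
      b * RtoC (cos (u * X) / (u * X)) + RtoC (cos (u * X) / (u ^ 2 * X)))
      (B := (Cmod b * B + B + / d * / X)%R); [exact Hb|lra| | |].
    - intros u Hu; eapply is_derive_C_eq.
      + apply is_derive_C_minus; [apply is_derive_C_plus|].
        * apply is_derive_C_mult; [apply is_derive_C_const|apply (is_derive_C_cos_trunc b Hb)].
        * apply (is_derive_C_sin_trunc b Hb); lra.
        * apply is_derive_C_RtoC; auto_derive; [nra|reflexivity].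
      + unfold E, Q.
        match goal with |- _ + _ - ?t = _ => replace t with (RtoC (- (sin (u * X) / u) - cos (u * X) / (u ^ 2 * X))) end.
        * rewrite RtoC_minus, RtoC_opp; ring.
        * f_equal; field; lra.
    - intros u Hu. assert (0 < u * X)%R by nra.
      assert (Hu2 : (d ^ 2 <= u ^ 2)%R) by (apply pow_incr; lra).
      assert (0 < u ^ 2 * X)%R by nra.
      eapply Rle_trans; [apply Cmod_triangle|]. rewrite Cmod_mult, !Cmod_R.
      rewrite Rmult_plus_distr_r; apply Rplus_le_compat.
      + unfold Rdiv at 2; rewrite Rmult_assoc; apply Rmult_le_compat_l; [apply Cmod_ge_0|].
        eapply Rle_trans; [apply Habs; [apply COS_bound|assumption]|now apply HinvD].
      + eapply Rle_trans; [apply Habs; [apply COS_bound|assumption]|].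
        rewrite <- Rinv_mult; apply Rinv_le_contravar; nra.
    - intros u Hu; assert (0 < u * X)%R by nra. destruct (HB u) as [H1 H2]; unfold E, Q.
      eapply Rle_trans; [apply Cmod_minus_le|]. apply Rplus_le_compat.
      + eapply Rle_trans; [apply Cmod_triangle|]. rewrite Cmod_mult.
        apply Rplus_le_compat; [apply Rmult_le_compat_l; [apply Cmod_ge_0|assumption]|assumption].
      + rewrite Cmod_R.
        eapply Rle_trans; [apply Habs; [apply COS_bound|assumption]|now apply HinvD]. }
  assert (HQ : forall u, (d <= u)%R -> (Cmod (Q u) <= k * / X)%R).
  { intros u Hu; specialize (HE u Hu); assert (0 < u * X)%R by nra.
    replace (Q u) with (E u + RtoC (cos (u * X) / (u * X))) by (unfold E; ring).
    eapply Rle_trans; [apply Cmod_triangle|].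
    unfold k; rewrite Rmult_plus_distr_r; apply Rplus_le_compat.
    - replace ((Cmod b / d + / d ^ 2) / r * / X)%R with ((Cmod b / d + / d ^ 2) * / X / r)%R by (field; lra).
      exact HE.
    - rewrite Cmod_R; eapply Rle_trans; [apply Habs; [apply COS_bound|assumption]|now apply HinvD]. }
  (* The equation Y' + b Y = Q is solved forwards from [d] to [a] with the factor exp(b u). *)
  set (G := fun u => Cexp (b * RtoC u) * cos_trunc b X u).
  assert (HG : (Cmod (G a - G d) <= k * / X / r * exp (r * a) - k * / X / r * exp (r * d))%R).
  { apply (Cmod_increment_le G (fun u => Cexp (b * u) * Q u) (fun u => k * / X / r * exp (r * u))%R
        (fun u => exp (r * u) * (k * / X))%R); [lra| | |].
    - intros u Hu; eapply is_derive_C_eq.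
      + apply is_derive_C_mult; [apply is_derive_C_exp_lin|apply (is_derive_C_cos_trunc b Hb)].
      + cbv beta; unfold Q; ring.
    - intros u _; evar_last; [apply is_derive_exp_lin|]. field; lra.
    - intros u Hu; rewrite Cmod_mult, Cmod_Cexp, Re_scal_R.
      apply Rmult_le_compat_l; [apply Rlt_le, exp_pos|apply HQ; lra]. }
  replace (cos_trunc b X a - Cexp (- b * RtoC (a - d)) * cos_trunc b X d)
    with (Cexp (- b * RtoC a) * (G a - G d)).
  2: { unfold G. replace (- b * RtoC (a - d)) with (- b * RtoC a + b * RtoC d) by (rewrite RtoC_minus; ring).
       rewrite Cexp_plus. replace (- b * RtoC a) with (- (b * RtoC a)) by ring.
       rewrite Cexp_opp. pose proof (Cexp_neq_0 (b * a)). field; assumption. }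
  rewrite Cmod_mult, Cmod_Cexp, Re_scal_R.
  replace (Re (- b) * a)%R with (- (r * a))%R by (unfold r, Re; simpl; ring).
  rewrite exp_Ropp. pose proof (exp_pos (r * a)) as Hp.
  apply Rmult_le_reg_l with (exp (r * a)); [exact Hp|].
  replace (exp (r * a) * (/ exp (r * a) * Cmod (G a - G d)))%R with (Cmod (G a - G d)) by (field; lra).
  assert (0 <= k * / X)%R by (eapply Rle_trans; [apply Cmod_ge_0|apply (HQ a Ha)]).
  assert (0 <= k * / X / r * exp (r * d))%R.
  { apply Rmult_le_pos; [apply Rdiv_le_0_compat; lra|apply Rlt_le, exp_pos]. }
  replace (exp (r * a) * (k / r * / X))%R with (k * / X / r * exp (r * a))%R by (field; lra). lra.
Qed.

(** For v <= 1 the left side is at most v^2/2, for v > 1 at most 2. The rational form merges both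
    cases, and at v = d x, divided by x^2, it becomes a multiple of the derivative of atan(d x). *)
Lemma one_minus_cos_le v : (0 <= v)%R -> (1 - cos v <= 4 * v ^ 2 / (1 + v ^ 2))%R.
Proof.
  intros Hv; pose proof (pow2_ge_0 v).
  apply Rmult_le_reg_r with (1 + v ^ 2)%R; [lra|].
  replace (4 * v ^ 2 / (1 + v ^ 2) * (1 + v ^ 2))%R with (4 * v ^ 2)%R by (field; lra).
  pose proof (COS_bound v).
  destruct (Rle_lt_dec v 1) as [H1|H1].
  - assert (E : (cos v = 1 - 2 * sin (v / 2) * sin (v / 2))%R)
      by (rewrite <- cos_2a_sin; f_equal; field).
    pose proof PI2_3_2.
    assert (0 <= sin (v / 2))%R by (apply sin_ge_0; lra).
    assert (sin (v / 2) <= v / 2)%R.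
    { destruct Hv as [Hv| <-]; [left; apply sin_lt_x; lra|].
      replace (0 / 2)%R with 0%R by field; rewrite sin_0; lra. }
    assert (v * v <= 1)%R by nra.
    assert (1 - cos v <= v ^ 2 / 2)%R by nra. nra.
  - nra.
Qed.

Lemma atan_scaled_int d X : (0 < d)%R ->
  is_RInt (fun x => d * / (1 + (d * x) ^ 2))%R 0 X (atan (d * X)).
Proof.
  intros Hd. replace (atan (d * X)) with (atan (d * X) - atan (d * 0))%R
    by (rewrite Rmult_0_r, atan_0; ring).
  assert (H : forall x, (1 + (d * x) ^ 2 <> 0)%R) by (intros x; pose proof (pow2_ge_0 (d * x)); lra).
  apply (is_RInt_derive (fun x => atan (d * x))).
  - intros x _; specialize (H x); auto_derive; [exact I|]. simpl in *; field; intros K; apply H; lra.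
  - intros x _; specialize (H x); apply @ex_derive_continuous; auto_derive. simpl in *; auto.
Qed.

(** Uniformity in [X] is the point, since [X] goes to infinity before [d] goes to 0. The difference
    is at most 4 L d atan(d X), and PI/2 <= 2 gives the factor 8. *)
Lemma cos_trunc_near_0 b (Hb : (0 < Re b)%R) : exists K, forall d X, (0 < d)%R -> (0 <= X)%R ->
  (Cmod (cos_trunc b X d - cos_trunc b X 0) <= K * d)%R.
Proof.
  destruct (inv_sqr_sum_le b Hb) as (L & HL & HD).
  exists (8 * L)%R; intros d X Hd HX.
  apply Rle_trans with (4 * L * d * atan (d * X))%R.
  - apply Cmod_CInt_le with (f := fun x => RtoC (cos (d * x)) * / (RtoC x ^ 2 + b ^ 2)
        - RtoC (cos (0 * x)) * / (RtoC x ^ 2 + b ^ 2))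
      (g := fun x => (4 * L * d * (d * / (1 + (d * x) ^ 2)))%R) (a := 0%R) (b := X); [exact HX| | |].
    + intros x Hx. rewrite Rmult_0_l, cos_0.
      replace (_ - _) with (RtoC (- (1 - cos (d * x))) * / (RtoC x ^ 2 + b ^ 2))
        by (rewrite RtoC_opp, RtoC_minus; ring).
      assert (Hv : (0 <= d * x)%R) by (apply Rmult_le_pos; lra).
      pose proof (one_minus_cos_le _ Hv) as H1.
      pose proof (COS_bound (d * x)).
      rewrite Cmod_mult, Cmod_R, Rabs_Ropp, Rabs_pos_eq by lra.
      pose proof (pow2_ge_0 x) as Hx2; pose proof (pow2_ge_0 (d * x)) as Hdx2.
      apply Rle_trans with ((4 * (d * x) ^ 2 / (1 + (d * x) ^ 2)) * (L * / (1 + x ^ 2)))%R.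
      * apply Rmult_le_compat; [lra|apply Cmod_ge_0|exact H1|apply HD].
      * replace (4 * (d * x) ^ 2 / (1 + (d * x) ^ 2) * (L * / (1 + x ^ 2)))%R
          with (4 * L * d * (d * / (1 + (d * x) ^ 2)) * (x ^ 2 * / (1 + x ^ 2)))%R
          by (field; simpl in *; lra).
        rewrite <- (Rmult_1_r (4 * L * d * (d * / (1 + (d * x) ^ 2)))) at 2.
        apply Rmult_le_compat_l.
        -- repeat apply Rmult_le_pos; try lra. apply Rlt_le, Rinv_0_lt_compat; lra.
        -- apply Rmult_le_reg_r with (1 + x ^ 2)%R; [lra|].
           rewrite Rmult_assoc, Rinv_l by lra. lra.
    + apply is_CInt_minus; now apply cos_trunc_correct.
    + apply @is_RInt_scal, atan_scaled_int, Hd.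
  - pose proof (atan_bound (d * X)) as [_ H]; pose proof PI_4.
    replace (8 * L * d)%R with (4 * L * d * 2)%R by ring.
    apply Rmult_le_compat_l; [|lra]. repeat apply Rmult_le_pos; lra.
Qed.

(** Going from [a] to [d] costs K/X with [K] depending on [d], whereas replacing [d] by 0 in the
    integral and in exp(-b(a - d)) costs O(d) with a constant independent of [d]. Hence the order of
    the quantifiers. *)
Lemma cos_trunc_estimate b a (Hb : (0 < Re b)%R) (Ha : (0 < a)%R) :
  exists C, (0 <= C)%R /\ forall d, (0 < d <= a)%R -> exists K X0, forall X, (X0 <= X)%R ->
  (Cmod (cos_trunc b X a - RtoC PI * Cexp (- b * RtoC a) / (2 * b)) <= K * / X + C * d)%R.
Proof.
  destruct (cos_trunc_near_0 b Hb) as (K0 & HK0).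
  destruct (inv_sqr_sum_int b Hb) as (K1 & HK1).
  set (J0 := RtoC PI / (2 * b)) in *.
  assert (HK0' : (0 <= K0)%R).
  { specialize (HK0 1%R 0%R Rlt_0_1 (Rle_refl _)).
    pose proof (Cmod_ge_0 (cos_trunc b 0 1 - cos_trunc b 0 0)); lra. }
  pose proof (Cmod_ge_0 b) as Hb0. pose proof (Cmod_ge_0 J0) as HJ0.
  exists (K0 + Cmod b * Cmod J0)%R; split; [apply Rplus_le_le_0_compat; [lra|now apply Rmult_le_pos]|].
  intros d [Hd Hda].
  destruct (cos_trunc_shift b Hb d Hd) as (K & HK).
  exists (K + K1)%R, (2 * Rabs (Im b) + 1)%R; intros X HX.
  pose proof (Rabs_pos (Im b)).
  assert (HX0 : (0 < X)%R) by lra.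
  specialize (HK a X Hda HX0). specialize (HK0 d X Hd (Rlt_le _ _ HX0)). specialize (HK1 X HX).
  assert (E0 : cos_trunc b X 0 = CInt (fun x => / (RtoC x ^ 2 + b ^ 2)) 0 X).
  { apply CInt_ext; intros x; rewrite Rmult_0_l, cos_0; ring. }
  rewrite <- E0 in HK1.
  set (e1 := Cexp (- b * RtoC (a - d))) in *. set (e0 := Cexp (- b * RtoC a)).
  assert (He1 : (Cmod e1 <= 1)%R).
  { unfold e1; rewrite Cmod_Cexp, Re_scal_R, <- exp_0.
    assert (H0 : (Re (- b) * (a - d) <= 0)%R) by (unfold Re in *; simpl in *; nra).
    destruct H0 as [H0| ->]; [left; now apply exp_increasing|lra]. }
  assert (He : (Cmod (e0 - e1) <= Cmod b * d)%R).
  { replace (Cmod b * d)%R with (Cmod b * a - Cmod b * (a - d))%R by ring.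
    apply (Cmod_increment_le (fun t => Cexp (- b * RtoC t)) (fun t => - b * Cexp (- b * t))
      (fun t => Cmod b * t)%R (fun _ => Cmod b)); [lra| | |].
    - intros; apply is_derive_C_exp_lin.
    - intros; auto_derive; [exact I|ring].
    - intros t Ht; rewrite Cmod_mult, Cmod_opp, Cmod_Cexp, Re_scal_R.
      rewrite <- (Rmult_1_r (Cmod b)) at 2; apply Rmult_le_compat_l; [exact Hb0|].
      rewrite <- exp_0.
      assert (H0 : (Re (- b) * t <= 0)%R) by (unfold Re in *; simpl in *; nra).
      destruct H0 as [H0| ->]; [left; now apply exp_increasing|lra]. }
  replace (cos_trunc b X a - PI * e0 / (2 * b)) with
    ((cos_trunc b X a - e1 * cos_trunc b X d)
     + (e1 * ((cos_trunc b X d - cos_trunc b X 0) + (cos_trunc b X 0 - J0)) - (e0 - e1) * J0)).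
  2: { unfold J0; field. now apply Re_pos_neq_0. }
  eapply Rle_trans; [apply Cmod_triangle|].
  assert (H2 : (Cmod ((e1 * ((cos_trunc b X d - cos_trunc b X 0) + (cos_trunc b X 0 - J0)) - (e0 - e1) * J0))
    <= (K0 * d + K1 * / X) + Cmod b * d * Cmod J0)%R).
  { eapply Rle_trans; [apply Cmod_minus_le|]. rewrite !Cmod_mult. apply Rplus_le_compat.
    - eapply Rle_trans; [|eapply Rle_trans; [apply Cmod_triangle|apply Rplus_le_compat; eassumption]].
      rewrite <- Rmult_1_l; apply Rmult_le_compat_r; [apply Cmod_ge_0|exact He1].
    - apply Rmult_le_compat_r; assumption. }
  lra.
Qed.

Lemma cos_integral b a : (0 < Re b)%R -> (0 < a)%R ->
  filterlim (fun X => cos_trunc b X a) (Rbar_locally p_infty)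
    (locally (T := C_UniformSpace) (RtoC PI * Cexp (- b * RtoC a) / (2 * b))).
Proof.
  intros Hb Ha; destruct (cos_trunc_estimate b a Hb Ha) as (C & HC & H).
  set (J := RtoC PI * Cexp (- b * RtoC a) / (2 * b)) in *.
  apply filterlim_Cmod with (g := fun X => Cmod (cos_trunc b X a - J)).
  - apply Rbar_locally_filter.
  - apply filter_forall; intros; apply Rle_refl.
  - apply (filterlim_locally (fun X => Cmod (cos_trunc b X a - J)) 0%R); intros eps.
    pose proof (cond_pos eps) as Heps.
    (* Makes C d < eps/2; dividing by [C + 1] covers [C = 0]. [d] is fixed before [X] because [K]
       and [X0] may depend on it. *)
    set (d := Rmin a (eps / (2 * (C + 1)))%R).
    assert (Hd : (0 < d)%R) by (apply Rmin_glb_lt; [exact Ha|apply Rdiv_lt_0_compat; lra]).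
    assert (HCd : (C * d < eps / 2)%R).
    { apply Rle_lt_trans with (C * (eps / (2 * (C + 1))))%R;
        [apply Rmult_le_compat_l; [lra|apply Rmin_r]|].
      replace (eps / 2)%R with ((C + 1) * (eps / (2 * (C + 1))))%R by (field; lra).
      apply Rmult_lt_compat_r; [apply Rdiv_lt_0_compat|]; lra. }
    destruct (H d) as (K & X0 & HK); [split; [exact Hd|apply Rmin_l]|].
    exists (Rmax X0 (Rmax 0 (2 * K / eps)))%R; intros X HX.
    pose proof (Rmax_l X0 (Rmax 0 (2 * K / eps)))%R.
    pose proof (Rmax_r X0 (Rmax 0 (2 * K / eps)))%R.
    pose proof (Rmax_l 0 (2 * K / eps))%R. pose proof (Rmax_r 0 (2 * K / eps))%R.
    specialize (HK X ltac:(lra)).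
    assert (HKX : (K * / X <= eps / 2)%R).
    { apply Rmult_le_reg_r with X; [lra|]. rewrite Rmult_assoc, Rinv_l by lra.
      assert (2 * K / eps * eps <= X * eps)%R by (apply Rmult_le_compat_r; lra).
      replace (2 * K / eps * eps)%R with (2 * K)%R in * by (field; lra). lra. }
    change (Rabs (Cmod (cos_trunc b X a - J) - 0) < eps)%R.
    rewrite Rminus_0_r, Rabs_pos_eq by apply Cmod_ge_0. lra.
Qed.

(** * Mittag-Leffler expansion and termwise integration *)

Lemma RtoC_2_neq_0 : RtoC 2 <> 0.
Proof. apply RtoC_neq_0; lra. Qed.

Lemma filterlim_Cmod_lt {T} (F : (T -> Prop) -> Prop) {FF : Filter F} (f : T -> C) (l : C) (eps : R) :
  filterlim f F (locally (T := C_UniformSpace) l) -> (0 < eps)%R ->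
  F (fun x => (Cmod (f x - l) < eps)%R).
Proof.
  intros H Heps; assert (He : (0 < eps / 2)%R) by lra.
  generalize (proj1 (filterlim_locally f l) H (mkposreal _ He)).
  apply filter_imp; intros x [H1 H2].
  change (Rabs (Re (f x - l)) < eps / 2)%R in H1. change (Rabs (Im (f x - l)) < eps / 2)%R in H2.
  set (z := f x - l) in *.
  replace z with (RtoC (Re z) + Ci * RtoC (Im z)) by (apply C_ext; simpl; unfold Re, Im; ring).
  eapply Rle_lt_trans; [apply Cmod_triangle|]. rewrite Cmod_mult, !Cmod_R.
  rewrite Cmod_Ci.
  lra.
Qed.

Lemma filterlim_Cplus {T} (F : (T -> Prop) -> Prop) {FF : Filter F} (f g : T -> C) (l m : C) :
  filterlim f F (locally (T := C_UniformSpace) l) ->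
  filterlim g F (locally (T := C_UniformSpace) m) ->
  filterlim (fun x => f x + g x) F (locally (T := C_UniformSpace) (l + m)).
Proof.
  intros Hf Hg; eapply filterlim_comp_2; [exact Hf|exact Hg|].
  apply (filterlim_plus (V := C_R_NormedModule)).
Qed.

Lemma filterlim_Cscal {T} (F : (T -> Prop) -> Prop) {FF : Filter F} (c : C) (f : T -> C) (l : C) :
  filterlim f F (locally (T := C_UniformSpace) l) ->
  filterlim (fun x => c * f x) F (locally (T := C_UniformSpace) (c * l)).
Proof.
  intros Hf; eapply filterlim_comp; [exact Hf|].
  apply (filterlim_scal_r (V := C_NormedModule) c l).
Qed.

Lemma filterlim_Cminus {T} (F : (T -> Prop) -> Prop) {FF : Filter F} (f g : T -> C) (l m : C) :
  filterlim f F (locally (T := C_UniformSpace) l) ->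
  filterlim g F (locally (T := C_UniformSpace) m) ->
  filterlim (fun x => f x - g x) F (locally (T := C_UniformSpace) (l - m)).
Proof.
  intros Hf Hg; replace (l - m) with (l + - (1) * m) by ring.
  apply filterlim_ext with (fun x => f x + - (1) * g x); [intros; ring|].
  apply filterlim_Cplus; [assumption..|now apply filterlim_Cscal].
Qed.

(** The real part alone decides non-vanishing here, because cosh is positive. *)
Lemma Re_Ccos z : Re (Ccos z) = (cos (Re z) * cosh (Im z))%R.
Proof.
  unfold Ccos, Cexp, cosh; destruct z as [x y]; simpl.
  replace (0 * x - 1 * y)%R with (- y)%R by ring.
  replace (0 * y + 1 * x)%R with x by ring.
  rewrite Ropp_involutive, cos_neg, sin_neg; field.
Qed.

Lemma Re_Csin z : Re (Csin z) = (sin (Re z) * cosh (Im z))%R.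
Proof.
  rewrite Csin_alt; unfold Cexp, cosh; destruct z as [x y]; simpl.
  replace (0 * x - 1 * y)%R with (- y)%R by ring.
  replace (0 * y + 1 * x)%R with x by ring.
  rewrite Ropp_involutive, cos_neg, sin_neg; field.
Qed.

Lemma cosh_pos x : (0 < cosh x)%R.
Proof. unfold cosh; pose proof (exp_pos x); pose proof (exp_pos (- x)); lra. Qed.

(** The variable [s] stands for -z^2, so that one family serves the integration axis, with s = x^2
    real, and the point z = gamma, with s = -gamma^2. *)
Definition ml_term (beta s : C) (k : nat) : C :=
  (odd_C k - beta) / (s + (odd_C k - beta) ^ 2) - (odd_C k + beta) / (s + (odd_C k + beta) ^ 2).

(** Translates the pole condition on the sum into the hypotheses of [tan_series] at w = beta + z and
    w = beta - z. *)
Lemma Ccos_sum_prod beta z :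
  Ccos (z * PI) + Ccos (beta * PI)
  = 2 * Ccos ((beta + z) * RtoC (PI / 2)) * Ccos ((beta - z) * RtoC (PI / 2)).
Proof.
  set (A := (beta + z) * RtoC (PI / 2)); set (B := (beta - z) * RtoC (PI / 2)).
  assert (EP : RtoC PI = RtoC (PI / 2) + RtoC (PI / 2)) by (rewrite <- RtoC_plus; f_equal; field).
  replace (z * PI) with (A + - B) by (unfold A, B; rewrite EP; ring).
  replace (beta * PI) with (A + B) by (unfold A, B; rewrite EP; ring).
  rewrite !Ccos_plus, Ccos_opp, Csin_opp; ring.
Qed.

Lemma Csin_sum_prod beta z (A := (beta + z) * RtoC (PI / 2)) (B := (beta - z) * RtoC (PI / 2)) :
  Csin (beta * PI) = Csin A * Ccos B + Ccos A * Csin B.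
Proof.
  rewrite <- Csin_plus; f_equal; unfold A, B.
  replace (RtoC PI) with (RtoC (PI / 2) + RtoC (PI / 2)) by (rewrite <- RtoC_plus; f_equal; field).
  ring.
Qed.

(** * The Mittag-Leffler expansion away from the poles *)

Section PoleFree.
Context (beta z : C) (H : Ccos (z * PI) + Ccos (beta * PI) <> 0).

(** All four expressions are products of two of the linear factors n - beta - z, n - beta + z, n +
    beta - z, n + beta + z. The tangents show all four to be nonzero, and the first two claims pair
    them differently. *)
Lemma pole_free k :
  (odd_C k - beta) ^ 2 - z ^ 2 <> 0 /\ (odd_C k + beta) ^ 2 - z ^ 2 <> 0
  /\ odd_C k ^ 2 - (beta + z) ^ 2 <> 0 /\ odd_C k ^ 2 - (beta - z) ^ 2 <> 0.
Proof.
  rewrite Ccos_sum_prod in H.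
  pose proof (Cmult_neq_0_r _ _ H) as HB. apply Cmult_neq_0_l, Cmult_neq_0_r in H as HA.
  destruct (odd_neq _ HA k) as [H1 _]. destruct (odd_neq _ HB k) as [H2 _].
  set (n := odd_C k) in *.
  replace (n ^ 2 - (beta + z) ^ 2) with ((n - beta - z) * (n + beta + z)) in H1 |- * by ring.
  replace (n ^ 2 - (beta - z) ^ 2) with ((n - beta + z) * (n + beta - z)) in H2 |- * by ring.
  repeat split; [| |assumption|assumption].
  - replace ((n - beta) ^ 2 - z ^ 2) with ((n - beta - z) * (n - beta + z)) by ring.
    apply Cmult_neq_0; eapply Cmult_neq_0_l; eassumption.
  - replace ((n + beta) ^ 2 - z ^ 2) with ((n + beta + z) * (n + beta - z)) by ring.
    apply Cmult_neq_0; eapply Cmult_neq_0_r; eassumption.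
Qed.

Lemma ml_term_tan k : ml_term beta (- z ^ 2) k = / 2 * (tan_term (beta + z) k + tan_term (beta - z) k).
Proof.
  destruct (pole_free k) as (H1 & H2 & H3 & H4). unfold ml_term, tan_term.
  set (n := odd_C k) in *.
  replace (- z ^ 2 + (n - beta) ^ 2) with ((n - beta - z) * (n - beta + z)) by ring.
  replace (- z ^ 2 + (n + beta) ^ 2) with ((n + beta + z) * (n + beta - z)) by ring.
  replace (n ^ 2 - (beta + z) ^ 2) with ((n - beta - z) * (n + beta + z)) in * by ring.
  replace (n ^ 2 - (beta - z) ^ 2) with ((n - beta + z) * (n + beta - z)) in * by ring.
  pose proof (Cmult_neq_0_l _ _ H3). pose proof (Cmult_neq_0_r _ _ H3).
  pose proof (Cmult_neq_0_l _ _ H4). pose proof (Cmult_neq_0_r _ _ H4).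
  field; auto.
Qed.

Lemma ml_series :
  filterlim (sum_n (G := C_AbelianMonoid) (ml_term beta (- z ^ 2))) eventually
    (locally (T := C_UniformSpace)
      (RtoC (PI / 2) * Csin (beta * PI) / (Ccos (z * PI) + Ccos (beta * PI)))).
Proof.
  pose proof H as HAB. rewrite Ccos_sum_prod in HAB.
  pose proof (Cmult_neq_0_r _ _ HAB) as HB. apply Cmult_neq_0_l, Cmult_neq_0_r in HAB as HA.
  rewrite Ccos_sum_prod, (Csin_sum_prod beta z).
  set (A := (beta + z) * RtoC (PI / 2)) in *. set (B := (beta - z) * RtoC (PI / 2)) in *.
  replace (RtoC (PI / 2) * (Csin A * Ccos B + Ccos A * Csin B) / (2 * Ccos A * Ccos B))
    with (/ 2 * (RtoC (PI / 2) * Csin A / Ccos A + RtoC (PI / 2) * Csin B / Ccos B)) by (field; auto).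
  apply filterlim_ext with (fun n => / 2 * (sum_n (G := C_AbelianMonoid) (tan_term (beta + z)) n
    + sum_n (G := C_AbelianMonoid) (tan_term (beta - z)) n)).
  - intros n; induction n as [|n IH].
    + rewrite !sum_O, ml_term_tan; reflexivity.
    + rewrite !sum_Sn, <- IH, ml_term_tan.
      repeat change (plus ?x ?y) with (Cplus x y). ring.
  - apply filterlim_Cscal; [apply eventually_filter|].
    apply filterlim_Cplus; [apply eventually_filter|apply tan_series, HA|apply tan_series, HB].
Qed.
End PoleFree.

(** All 2k+1-beta and 2k+1+beta share one |Im| and have real parts bounded below, so they lie in a
    common sector around the positive axis. [L] is its opening; squaring Im covers both signs. *)
Lemma Cmod_le_Re_scaled (q0 r0 : R) : (0 < r0)%R -> exists L, (1 <= L)%R /\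
  forall b : C, (r0 <= Re b)%R -> (Im b ^ 2 = q0 ^ 2)%R -> (Cmod b ^ 2 <= L * Re b ^ 2)%R.
Proof.
  intros Hr; exists (1 + q0 ^ 2 / r0 ^ 2)%R.
  assert (Hr2 : (0 < r0 ^ 2)%R) by (apply pow_lt; lra).
  assert (Hq : (0 <= q0 ^ 2 / r0 ^ 2)%R) by (apply Rdiv_le_0_compat; [apply pow2_ge_0|lra]).
  split; [lra|]. intros b Hb Hi; rewrite Cmod2_alt, Hi.
  assert (r0 ^ 2 <= Re b ^ 2)%R by (apply pow_incr; lra).
  assert (q0 ^ 2 / r0 ^ 2 * r0 ^ 2 <= q0 ^ 2 / r0 ^ 2 * Re b ^ 2)%R by (apply Rmult_le_compat_l; lra).
  replace (q0 ^ 2 / r0 ^ 2 * r0 ^ 2)%R with (q0 ^ 2)%R in * by (field; lra). lra.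
Qed.

(** Over a common denominator the numerator is -2 beta (x^2 - b c). Its second factor is absorbed by
    x^2 + c^2, and the remaining 1/(x^2 + b^2) is O(1/k^2) uniformly in x. The bound is written so
    as to telescope. *)
Lemma ml_term_le beta : (0 < Re beta < 1)%R ->
  exists M, (0 <= M)%R /\ forall x k,
    (Cmod (ml_term beta (RtoC x ^ 2) k) <= M * (/ (INR k + 2 - 1) - / (INR k + 2)))%R.
Proof.
  intros Hp; set (p := Re beta) in *.
  destruct (Cmod_le_Re_scaled (Im beta) (1 - p)%R) as (L & HL1 & HL); [lra|].
  pose proof (Cmod_ge_0 beta) as Hb0.
  assert (Hp2 : (0 < (1 - p) ^ 2)%R) by (apply pow_lt; lra).
  (* 2|beta| comes from c - b, then 2 L^2 from the numerator against [Dc], and 4L/(1-p)^2 from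
     1/[Db]. *)
  exists (16 * Cmod beta * L ^ 3 / (1 - p) ^ 2)%R. split.
  { apply Rdiv_le_0_compat; [|lra]. repeat apply Rmult_le_pos; lra. }
  intros x k; pose proof (pos_INR k) as Hk.
  unfold ml_term; set (b := odd_C k - beta); set (c := odd_C k + beta).
  assert (Hrb : Re b = (2 * INR k + 1 - p)%R) by (unfold b, odd_C, p, Re; simpl; ring).
  assert (Hrc : Re c = (2 * INR k + 1 + p)%R) by (unfold c, odd_C, p, Re; simpl; ring).
  assert (Hib : (Im b ^ 2 = Im beta ^ 2)%R) by (unfold b, odd_C, Im; simpl; ring).
  assert (Hic : (Im c ^ 2 = Im beta ^ 2)%R) by (unfold c, odd_C, Im; simpl; ring).
  assert (Hb : (0 < Re b)%R) by lra. assert (Hc : (0 < Re c)%R) by lra.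
  pose proof (HL b ltac:(lra) Hib) as HLb. pose proof (HL c ltac:(lra) Hic) as HLc.
  pose proof (pow2_ge_0 x) as Hx.
  assert (Hlow : forall d : C, (0 < Re d)%R -> (Cmod d ^ 2 <= L * Re d ^ 2)%R ->
    (x ^ 2 + Re d ^ 2 <= 2 * L * Cmod (RtoC x ^ 2 + d ^ 2))%R).
  { intros d Hd HLd; pose proof (sqr_sum_le_Cmod d x) as H.
    assert (H0 : (0 < Re d ^ 2)%R) by (apply pow_lt; lra).
    pose proof (Cmod_ge_0 (RtoC x ^ 2 + d ^ 2)).
    apply Rmult_le_reg_l with (Re d ^ 2)%R; [exact H0|].
    eapply Rle_trans; [exact H|].
    replace (Re d ^ 2 * (2 * L * Cmod (RtoC x ^ 2 + d ^ 2)))%R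
      with (2 * (L * Re d ^ 2) * Cmod (RtoC x ^ 2 + d ^ 2))%R by ring.
    apply Rmult_le_compat_r; lra. }
  pose proof (Hlow b Hb HLb) as HDb. pose proof (Hlow c Hc HLc) as HDc.
  pose proof (sqr_sum_neq_0 b x Hb) as Nb. pose proof (sqr_sum_neq_0 c x Hc) as Nc.
  set (Db := RtoC x ^ 2 + b ^ 2) in *. set (Dc := RtoC x ^ 2 + c ^ 2) in *.
  pose proof (proj1 (Cmod_gt_0 Db) Nb) as Pb. pose proof (proj1 (Cmod_gt_0 Dc) Nc) as Pc.
  replace (b / Db - c / Dc) with (- (2) * beta * (RtoC x ^ 2 - b * c) / (Db * Dc)).
  2: { assert (E : b * Dc - c * Db = - (2) * beta * (RtoC x ^ 2 - b * c)) by (unfold Db, Dc, b, c; ring).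
       rewrite <- E; field; auto. }
  rewrite Cmod_div by (apply Cmult_neq_0; assumption).
  rewrite !Cmod_mult, Cmod_opp, (Cmod_R 2), Rabs_pos_eq by lra.
  (* |b||c| is bounded by the mean of |b|^2 and |c|^2, and Re b <= Re c. *)
  assert (Hnum : (Cmod (RtoC x ^ 2 - b * c) <= L * (x ^ 2 + Re c ^ 2))%R).
  { eapply Rle_trans; [apply Cmod_minus_le|].
    rewrite <- RtoC_pow, Cmod_R, Rabs_pos_eq, Cmod_mult by exact Hx.
    pose proof (pow2_ge_0 (Cmod b - Cmod c)).
    assert (Re b ^ 2 <= Re c ^ 2)%R by (apply pow_incr; lra).
    assert (L * Re b ^ 2 <= L * Re c ^ 2)%R by (apply Rmult_le_compat_l; lra).
    assert (1 * x ^ 2 <= L * x ^ 2)%R by (apply Rmult_le_compat_r; lra). nra. }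
  apply Rmult_le_reg_r with (Cmod Db * Cmod Dc)%R; [now apply Rmult_lt_0_compat|].
  replace (2 * Cmod beta * Cmod (RtoC x ^ 2 - b * c) / (Cmod Db * Cmod Dc) * (Cmod Db * Cmod Dc))%R
    with (2 * Cmod beta * Cmod (RtoC x ^ 2 - b * c))%R by (field; lra).
  apply Rle_trans with (2 * Cmod beta * (L * (2 * L * Cmod Dc)))%R.
  { apply Rmult_le_compat_l; [lra|]. eapply Rle_trans; [exact Hnum|].
    apply Rmult_le_compat_l; lra. }
  (* Re b = 2k + 1 - p is at least (1 - p)(k + 1), a form that also covers k = 0. *)
  assert (Hk2 : ((1 - p) ^ 2 * (INR k + 1) ^ 2 <= 2 * L * Cmod Db)%R).
  { rewrite <- Rpow_mult_distr. apply Rle_trans with (Re b ^ 2)%R; [|lra].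
    apply pow_incr; rewrite Hrb; split; nra. }
  replace (/ (INR k + 2 - 1) - / (INR k + 2))%R with (/ ((INR k + 1) * (INR k + 2)))%R by (field; lra).
  assert (Hk3 : (1 <= 8 * L / (4 * (1 - p) ^ 2) * / ((INR k + 1) * (INR k + 2)) * (2 * Cmod Db))%R).
  { assert (H1 : (0 < (INR k + 1) * (INR k + 2))%R) by nra.
    assert (H2 : (0 < (1 - p) ^ 2 * ((INR k + 1) * (INR k + 2)))%R) by (apply Rmult_lt_0_compat; lra).
    apply Rmult_le_reg_l with ((1 - p) ^ 2 * ((INR k + 1) * (INR k + 2)))%R; [exact H2|].
    replace (_ * (8 * L / (4 * (1 - p) ^ 2) * / ((INR k + 1) * (INR k + 2)) * (2 * Cmod Db)))%R
      with (2 * (2 * L * Cmod Db))%R by (field; lra).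
    assert (((INR k + 1) * (INR k + 2)) <= 2 * (INR k + 1) ^ 2)%R by nra.
    assert ((1 - p) ^ 2 * ((INR k + 1) * (INR k + 2)) <= (1 - p) ^ 2 * (2 * (INR k + 1) ^ 2))%R
      by (apply Rmult_le_compat_l; lra). lra. }
  replace (16 * Cmod beta * L ^ 3 / (1 - p) ^ 2 * / ((INR k + 1) * (INR k + 2)) * (Cmod Db * Cmod Dc))%R
    with (2 * Cmod beta * (L * (2 * L * Cmod Dc))
      * (8 * L / (4 * (1 - p) ^ 2) * / ((INR k + 1) * (INR k + 2)) * (2 * Cmod Db)))%R by (field; lra).
  rewrite <- (Rmult_1_r (2 * Cmod beta * (L * (2 * L * Cmod Dc)))) at 1.
  apply Rmult_le_compat_l; [|exact Hk3].
  repeat apply Rmult_le_pos; lra.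
Qed.

(** The sum of the majorants from n+1 to n+j telescopes to 1/(n+2) - 1/(n+j+2); then j tends to
    infinity. *)
Lemma sum_tail_le (u : nat -> C) (l : C) (M : R) :
  (0 <= M)%R ->
  (forall k, (Cmod (u k) <= M * (/ (INR k + 2 - 1) - / (INR k + 2)))%R) ->
  filterlim (sum_n (G := C_AbelianMonoid) u) eventually (locally (T := C_UniformSpace) l) ->
  forall n, (Cmod (sum_n (G := C_AbelianMonoid) u n - l) <= M * / (INR n + 2))%R.
Proof.
  intros HM Hu Hl n; set (s := sum_n (G := C_AbelianMonoid) u) in *.
  assert (Ht : forall j, (Cmod (s (n + j)%nat - s n) <= M * (/ (INR n + 2) - / (INR (n + j) + 2)))%R).
  { induction j as [|j IH].
    - rewrite Nat.add_0_r; replace (s n - s n) with (RtoC 0) by ring. rewrite Cmod_0; lra.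
    - replace (n + S j)%nat with (S (n + j)) by lia. unfold s; rewrite sum_Sn; fold s.
      change (plus ?x ?y) with (Cplus x y).
      replace (s (n + j)%nat + u (S (n + j)) - s n) with ((s (n + j)%nat - s n) + u (S (n + j))) by ring.
      eapply Rle_trans; [apply Cmod_triangle|]. specialize (Hu (S (n + j))).
      rewrite S_INR in *.
      replace (INR (n + j) + 1 + 2 - 1)%R with (INR (n + j) + 2)%R in Hu by ring. lra. }
  apply le_epsilon; intros eps Heps.
  destruct (filterlim_Cmod_lt eventually s l eps Hl Heps) as [N HN].
  specialize (HN (n + N)%nat ltac:(lia)). specialize (Ht N).
  replace (s n - l) with ((s (n + N)%nat - l) - (s (n + N)%nat - s n)) by ring.
  eapply Rle_trans; [apply Cmod_minus_le|].
  assert (0 <= M * / (INR (n + N) + 2))%R.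
  { apply Rmult_le_pos; [exact HM|]. pose proof (pos_INR (n + N)).
    apply Rlt_le, Rinv_0_lt_compat; lra. }
  lra.
Qed.

(* From [b / ((x^2 + gamma^2) (x^2 + b^2)) = b / (gamma^2 - b^2) (1 / (x^2 + b^2) - 1 / (x^2 + gamma^2))]. *)
Definition pf (b gamma u v : C) : C := b / (gamma ^ 2 - b ^ 2) * (u - v).

Lemma sum_n_CInt (f : nat -> R -> C) (I : nat -> C) a b :
  (forall k, is_CInt (f k) a b (I k)) ->
  forall n, is_CInt (fun x => sum_n (G := C_AbelianMonoid) (fun k => f k x) n) a b
    (sum_n (G := C_AbelianMonoid) I n).
Proof.
  intros Hf n; induction n as [|n IH].
  - rewrite sum_O. apply (is_RInt_ext (V := C_R_NormedModule) (f 0%nat)); [|apply Hf].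
    intros; now rewrite sum_O.
  - rewrite sum_Sn.
    apply (is_RInt_ext (V := C_R_NormedModule)
      (fun x => sum_n (G := C_AbelianMonoid) (fun k => f k x) n + f (S n) x)).
    + intros; now rewrite sum_Sn.
    + now apply is_CInt_plus.
Qed.

Lemma filterlim_sum_n {T} (F : (T -> Prop) -> Prop) {FF : Filter F} (f : nat -> T -> C) (l : nat -> C) :
  (forall k, filterlim (f k) F (locally (T := C_UniformSpace) (l k))) ->
  forall n, filterlim (fun x => sum_n (G := C_AbelianMonoid) (fun k => f k x) n) F
    (locally (T := C_UniformSpace) (sum_n (G := C_AbelianMonoid) l n)).
Proof.
  intros Hf n; induction n as [|n IH].
  - rewrite sum_O; apply filterlim_ext with (f 0%nat); [intros; now rewrite sum_O|apply Hf].
  - rewrite sum_Sn.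
    apply filterlim_ext with (fun x => sum_n (G := C_AbelianMonoid) (fun k => f k x) n + f (S n) x).
    + intros; now rewrite sum_Sn.
    + now apply filterlim_Cplus.
Qed.

Lemma sum_n_Cscal c (u : nat -> C) n :
  sum_n (G := C_AbelianMonoid) (fun k => c * u k) n = c * sum_n (G := C_AbelianMonoid) u n.
Proof.
  induction n as [|n IH]; [now rewrite !sum_O|].
  rewrite !sum_Sn, IH. repeat change (plus ?x ?y) with (Cplus x y); eq_C; ring.
Qed.

Lemma sum_n_Cplus (u v : nat -> C) n :
  sum_n (G := C_AbelianMonoid) (fun k => u k + v k) n
  = sum_n (G := C_AbelianMonoid) u n + sum_n (G := C_AbelianMonoid) v n.
Proof.
  induction n as [|n IH]; [now rewrite !sum_O|].
  rewrite !sum_Sn, IH. repeat change (plus ?x ?y) with (Cplus x y); eq_C; ring.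
Qed.

Lemma inv_1_sqr_int X : is_RInt (fun x => / (1 + x ^ 2))%R 0 X (atan X).
Proof.
  rewrite <- (Rmult_1_l X) at 2.
  apply (is_RInt_ext (fun x => 1 * / (1 + (1 * x) ^ 2))%R).
  - intros; now rewrite !Rmult_1_l.
  - apply atan_scaled_int, Rlt_0_1.
Qed.

(** The lower end is exactly 0 and the filter at infinity lets [X] exceed max(N, 0), so only
    nonnegative upper ends need an integral. *)
Lemma is_CInt_0_infty_intro (f : R -> C) (G : R -> C) (l : C) :
  (forall X, (0 <= X)%R -> is_CInt f 0 X (G X)) ->
  filterlim G (Rbar_locally p_infty) (locally (T := C_UniformSpace) l) ->
  is_CInt_0_infty f l.
Proof.
  intros Hf HG P HP; specialize (HG P HP). destruct HG as [N HN].
  apply (Filter_prod _ _ _ (fun x => x = 0%R) (fun X => (Rmax N 0 < X)%R)).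
  - reflexivity.
  - exists (Rmax N 0); auto.
  - intros x X -> HX; simpl. exists (G X).
    pose proof (Rmax_l N 0); pose proof (Rmax_r N 0).
    split; [apply Hf; lra|apply HN; lra].
Qed.

(** [filterlim_switch] wants uniformity over all real [X], while the estimates hold for X >= 0;
    clamping reconciles the two without touching the limit. *)
Lemma filterlim_Rmax_0 (F : (C -> Prop) -> Prop) (f : R -> C) :
  filterlim (fun X => f (Rmax 0 X)) (Rbar_locally p_infty) F <-> filterlim f (Rbar_locally p_infty) F.
Proof.
  assert (H : Rbar_locally p_infty (fun X => Rmax 0 X = X)).
  { exists 0%R; intros; apply Rmax_right; lra. }
  split; intros Hf; eapply filterlim_ext_loc; try exact Hf;
    generalize H; apply filter_imp; intros X E; cbv beta; now rewrite E.
Qed.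

(** * Exchange of summation and integration *)

Section TermwiseIntegration.
Context (beta gamma : C) (a : R)
  (hbeta : (0 < Re beta < 1)%R) (hgamma : (0 < Re gamma)%R) (ha : (0 < a)%R)
  (hpole : Ccos (gamma * PI) + Ccos (beta * PI) <> 0).

Lemma Csin_beta_neq_0 : Csin (beta * PI) <> 0.
Proof.
  intros E; pose proof (Re_Csin (beta * PI)) as H; rewrite E, Re_scal_R in H.
  pose proof (cosh_pos (Im (beta * PI))). pose proof PI_RGT_0.
  assert (0 < sin (Re beta * PI))%R by (apply sin_gt_0; nra).
  rewrite re_RtoC in H; pose proof (Rmult_lt_0_compat _ _ H2 H0); lra.
Qed.

(** On the axis z = i x both cosines of [Ccos_sum_prod] have an argument with real part Re(beta)
    PI/2, inside (0, PI/2), so their real parts are positive. *)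
Lemma cosh_cos_neq_0 x : Ccos (Ci * RtoC x * PI) + Ccos (beta * PI) <> 0.
Proof.
  rewrite Ccos_sum_prod; pose proof PI_RGT_0.
  apply Cmult_neq_0; [apply Cmult_neq_0; [apply RtoC_2_neq_0|]|];
  (intros E; apply (f_equal Re) in E; rewrite Re_Ccos, Re_scal_R in E;
   match type of E with context [cosh ?y] => pose proof (cosh_pos y) as Hc end;
   match type of E with context [cos (?r * _)] => replace r with (Re beta) in E by (unfold Re; simpl; ring) end;
   assert (Hp : (0 < cos (Re beta * (PI / 2)))%R) by (apply cos_gt_0; nra);
   rewrite re_RtoC in E; pose proof (Rmult_lt_0_compat _ _ Hp Hc); lra).
Qed.

Definition ml_limit (x : R) : C :=
  RtoC (PI / 2) * Csin (beta * PI) / (Ccos (Ci * RtoC x * PI) + Ccos (beta * PI)).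

Lemma ml_limit_series x :
  filterlim (sum_n (G := C_AbelianMonoid) (ml_term beta (RtoC x ^ 2))) eventually
    (locally (T := C_UniformSpace) (ml_limit x)).
Proof.
  replace (RtoC x ^ 2) with (- (Ci * RtoC x) ^ 2).
  - apply ml_series, cosh_cos_neq_0.
  - transitivity (- (Ci * Ci) * RtoC x ^ 2); [ring|rewrite Ci2; ring].
Qed.

Definition weight (x : R) : C := RtoC (cos (a * x)) * / (RtoC x ^ 2 + gamma ^ 2).

Lemma ml_limit_continuous x : continuous_C ml_limit x.
Proof.
  unfold ml_limit.
  apply continuous_C_mult; [apply continuous_C_const|].
  eapply is_derive_C_continuous, is_derive_C_inv.
  2: apply cosh_cos_neq_0.
  apply is_derive_C_plus; [|apply is_derive_C_const].
  eapply is_derive_C_ext; [|apply (is_derive_C_Ccos (Ci * PI) x)].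
  intros y; cbv beta; f_equal; ring.
Qed.

Lemma weight_continuous x : continuous_C weight x.
Proof.
  unfold weight; apply continuous_C_mult; [apply continuous_C_RtoC, continuous_cos_scaled|].
  now apply continuous_inv_sqr_sum.
Qed.

Definition trunc (X : R) : C := CInt (fun x => weight x * ml_limit x) 0 X.

Lemma trunc_correct X : (0 <= X)%R -> is_CInt (fun x => weight x * ml_limit x) 0 X (trunc X).
Proof.
  intros HX; apply CInt_correct; [exact HX|]; intros t _.
  apply continuous_C_mult; [apply weight_continuous|apply ml_limit_continuous].
Qed.

Definition mode_trunc (X : R) (k : nat) : C :=
  pf (odd_C k - beta) gamma (cos_trunc (odd_C k - beta) X a) (cos_trunc gamma X a)
  - pf (odd_C k + beta) gamma (cos_trunc (odd_C k + beta) X a) (cos_trunc gamma X a).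

Lemma Re_odd_pos k : (0 < Re (odd_C k - beta))%R /\ (0 < Re (odd_C k + beta))%R.
Proof.
  pose proof (pos_INR k). unfold odd_C, Re in *; simpl; split; lra.
Qed.

Lemma gamma_poles k : gamma ^ 2 - (odd_C k - beta) ^ 2 <> 0 /\ gamma ^ 2 - (odd_C k + beta) ^ 2 <> 0.
Proof.
  destruct (pole_free beta gamma hpole k) as (H1 & H2 & _).
  split; intros E; [apply H1|apply H2].
  - transitivity (- (gamma ^ 2 - (odd_C k - beta) ^ 2)); [ring|rewrite E; ring].
  - transitivity (- (gamma ^ 2 - (odd_C k + beta) ^ 2)); [ring|rewrite E; ring].
Qed.

Lemma pf_trunc b X : (0 < Re b)%R -> gamma ^ 2 - b ^ 2 <> 0 -> (0 <= X)%R ->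
  is_CInt (fun x => weight x * (b / (RtoC x ^ 2 + b ^ 2))) 0 X
    (pf b gamma (cos_trunc b X a) (cos_trunc gamma X a)).
Proof.
  intros Hb Hne HX.
  eapply is_CInt_ext; [exact HX| |apply is_CInt_scal, is_CInt_minus; apply cos_trunc_correct; eassumption].
  intros x _; unfold weight.
  pose proof (sqr_sum_neq_0 b x Hb). pose proof (sqr_sum_neq_0 gamma x hgamma).
  field; auto.
Qed.

Lemma mode_trunc_correct X k : (0 <= X)%R ->
  is_CInt (fun x => weight x * ml_term beta (RtoC x ^ 2) k) 0 X (mode_trunc X k).
Proof.
  intros HX; destruct (Re_odd_pos k); destruct (gamma_poles k).
  eapply is_CInt_ext; [exact HX| |apply is_CInt_minus; apply pf_trunc; assumption].
  intros x _; unfold ml_term; ring.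
Qed.

Definition mode_limit (k : nat) : C :=
  let T b := RtoC PI * Cexp (- b * RtoC a) / (2 * b) in
  pf (odd_C k - beta) gamma (T (odd_C k - beta)) (T gamma)
  - pf (odd_C k + beta) gamma (T (odd_C k + beta)) (T gamma).

Lemma mode_trunc_lim k :
  filterlim (fun X => mode_trunc X k) (Rbar_locally p_infty) (locally (T := C_UniformSpace) (mode_limit k)).
Proof.
  assert (Hpf : forall b, (0 < Re b)%R ->
    filterlim (fun X => pf b gamma (cos_trunc b X a) (cos_trunc gamma X a)) (Rbar_locally p_infty)
      (locally (T := C_UniformSpace) (pf b gamma (RtoC PI * Cexp (- b * RtoC a) / (2 * b))
        (RtoC PI * Cexp (- gamma * RtoC a) / (2 * gamma))))).
  { intros b Hb; apply filterlim_Cscal; [apply Rbar_locally_filter|].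
    apply filterlim_Cminus; [apply Rbar_locally_filter| |]; now apply cos_integral. }
  destruct (Re_odd_pos k).
  apply filterlim_Cminus; [apply Rbar_locally_filter| |]; now apply Hpf.
Qed.

(** The tail of the expansion is bounded uniformly in x, and the weight has an integral of at most
    2L in modulus over every [0, X]; the result is uniform in [X]. *)
Lemma partial_trunc_close : exists M, (0 <= M)%R /\ forall n X, (0 <= X)%R ->
  (Cmod (sum_n (G := C_AbelianMonoid) (mode_trunc X) n - trunc X) <= M * / (INR n + 2))%R.
Proof.
  destruct (ml_term_le beta hbeta) as (M & HM & Hml).
  destruct (inv_sqr_sum_le gamma hgamma) as (L & HL & HD).
  exists (M * L * 2)%R; split; [repeat apply Rmult_le_pos; lra|]; intros n X HX.
  pose proof (pos_INR n) as Hn.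
  assert (Hn2 : (0 < / (INR n + 2))%R) by (apply Rinv_0_lt_compat; lra).
  apply Rle_trans with (M * / (INR n + 2) * L * atan X)%R.
  - eapply Cmod_CInt_le; [exact HX| |apply is_CInt_minus;
      [apply (sum_n_CInt (fun k x => weight x * ml_term beta (RtoC x ^ 2) k)); intros k;
       now apply mode_trunc_correct|now apply trunc_correct]|
      apply @is_RInt_scal, inv_1_sqr_int].
    intros x _; cbv beta.
    rewrite sum_n_Cscal.
    replace (_ - _) with (weight x * (sum_n (G := C_AbelianMonoid) (ml_term beta (RtoC x ^ 2)) n - ml_limit x)) by ring.
    pose proof (sum_tail_le _ _ M HM (Hml x) (ml_limit_series x) n) as Ht.
    rewrite Cmod_mult, Rmult_comm. unfold scal; simpl; unfold mult; simpl. rewrite Rmult_assoc.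
    apply Rmult_le_compat; [apply Cmod_ge_0|apply Cmod_ge_0|exact Ht|].
    unfold weight; rewrite Cmod_mult, Cmod_R.
    assert (Rabs (cos (a * x)) <= 1)%R by (apply Rabs_le; pose proof (COS_bound (a * x)); lra).
    eapply Rle_trans; [|apply HD]. rewrite <- Rmult_1_l.
    apply Rmult_le_compat_r; [apply Cmod_ge_0|assumption].
  - pose proof (atan_bound X) as [_ H]; pose proof PI_4.
    replace (M * L * 2 * / (INR n + 2))%R with (M * / (INR n + 2) * L * 2)%R by ring.
    apply Rmult_le_compat_l; [|lra]. repeat apply Rmult_le_pos; lra.
Qed.

(** Moore-Osgood: uniform convergence in n, and a limit in X for each n. The common limit comes out
    of the exchange, which thereby also proves that the series of [mode_limit] converges. *)
Lemma exchange_limits : exists l : C,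
  filterlim (sum_n (G := C_AbelianMonoid) mode_limit) eventually (locally (T := C_UniformSpace) l)
  /\ filterlim trunc (Rbar_locally p_infty) (locally (T := C_UniformSpace) l).
Proof.
  destruct partial_trunc_close as (M & HM & Hclose).
  destruct (filterlim_switch (U := C_R_CompleteNormedModule) _ eventually_filter _ (Rbar_locally_filter p_infty)
    (fun n X => sum_n (G := C_AbelianMonoid) (mode_trunc (Rmax 0 X)) n)
    (fun X => trunc (Rmax 0 X)) (sum_n (G := C_AbelianMonoid) mode_limit)) as (l & H1 & H2).
  - apply filterlim_locally; intros eps.
    pose proof (cond_pos eps) as Heps.
    destruct (nfloor_ex (M / eps)%R) as (N & _ & HN); [apply Rdiv_le_0_compat; lra|].
    exists N; intros n Hn X.
    assert (Hlt : (Cmod (sum_n (G := C_AbelianMonoid) (mode_trunc (Rmax 0 X)) n - trunc (Rmax 0 X)) < eps)%R).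
    { eapply Rle_lt_trans; [apply Hclose, Rmax_l|].
      apply le_INR in Hn; pose proof (pos_INR n).
      apply Rmult_lt_reg_r with (INR n + 2)%R; [lra|].
      rewrite Rmult_assoc, Rinv_l by lra.
      assert (M / eps * eps < (INR N + 1) * eps)%R by (apply Rmult_lt_compat_r; lra).
      replace (M / eps * eps)%R with M in * by (field; lra). nra. }
    set (z := sum_n (G := C_AbelianMonoid) (mode_trunc (Rmax 0 X)) n - trunc (Rmax 0 X)) in *.
    split; [change (Rabs (Re z) < eps)%R|change (Rabs (Im z) < eps)%R].
    + eapply Rle_lt_trans; [apply re_le_Cmod|exact Hlt].
    + eapply Rle_lt_trans; [|exact Hlt].
      eapply Rle_trans; [apply Rmax_r|apply (Rmax_Cmod z)].
  - intros n.
    apply (filterlim_Rmax_0 _ (fun X => sum_n (G := C_AbelianMonoid) (mode_trunc X) n)).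
    apply filterlim_sum_n; [apply Rbar_locally_filter|apply mode_trunc_lim].
  - exists l; split; [exact H1|apply filterlim_Rmax_0; exact H2].
Qed.

(** In the exponential of b = 2k+1-beta, and likewise of 2k+1+beta, the factor b of [pf] cancels the
    one in PI/(2b). The coefficient -b/(gamma^2 - b^2) of the exponential of gamma is b/(s + b^2) at
    s = -gamma^2. *)
Lemma mode_limit_eq k :
  mode_limit k = RtoC (PI / 2) * series_term beta gamma a k
    + RtoC PI * Cexp (- gamma * RtoC a) / (2 * gamma) * ml_term beta (- gamma ^ 2) k.
Proof.
  destruct (Re_odd_pos k) as [Hb Hc]; destruct (gamma_poles k) as [H1 H2].
  apply Re_pos_neq_0 in Hb; apply Re_pos_neq_0 in Hc. pose proof (Re_pos_neq_0 _ hgamma).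
  unfold mode_limit, series_term, pf, ml_term. fold (odd_C k).
  set (b := odd_C k - beta) in *; set (c := odd_C k + beta) in *.
  replace (- (b * RtoC a)) with (- b * RtoC a) by ring.
  replace (- (c * RtoC a)) with (- c * RtoC a) by ring.
  replace (- gamma ^ 2 + b ^ 2) with (- (gamma ^ 2 - b ^ 2)) by ring.
  replace (- gamma ^ 2 + c ^ 2) with (- (gamma ^ 2 - c ^ 2)) by ring.
  replace (RtoC (PI / 2)) with (RtoC PI / 2) by (rewrite RtoC_div by lra; reflexivity).
  set (db := gamma ^ 2 - b ^ 2) in *; set (dc := gamma ^ 2 - c ^ 2) in *.
  field; repeat split; try assumption.
Qed.

Lemma integrand_eq x :
  integrand beta gamma a x = 2 / (RtoC PI * Csin (beta * PI)) * (weight x * ml_limit x).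
Proof.
  unfold integrand, weight, ml_limit.
  pose proof (cosh_cos_neq_0 x) as H. pose proof Csin_beta_neq_0.
  pose proof (sqr_sum_neq_0 gamma x hgamma). pose proof PI_RGT_0.
  assert (RtoC PI <> 0) by (apply RtoC_neq_0; lra).
  replace (Ci * RtoC x * PI) with (Ci * RtoC (PI * x)) in * by (rewrite RtoC_mult; ring).
  rewrite Ccos_Ci in *. rewrite (Cmult_comm (RtoC PI) beta).
  replace (RtoC (PI / 2)) with (RtoC PI / 2) by (rewrite RtoC_div by lra; reflexivity).
  field; repeat split; assumption.
Qed.

End TermwiseIntegration.

(** [hpole] keeps gamma away from all 2k+1-beta and 2k+1+beta, where the closed term and a summand
    would divide by zero. Convergence of the series is part of the claim. *)
Theorem mainTheorem13 (beta gamma : C) (a : R)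
  (hbeta : (0 < Re beta < 1)%R) (hgamma : (0 < Re gamma)%R) (ha : (0 < a)%R)
  (hpole : Ccos (gamma * PI) + Ccos (beta * PI) <> 0) :
  exists S : C,
    @is_series C_AbsRing C_NormedModule (series_term beta gamma a) S /\
    is_CInt_0_infty (integrand beta gamma a)
      (PI * Cexp (- (a * gamma))
         / (2 * gamma * (Ccos (gamma * PI) + Ccos (beta * PI)))
       + 1 / Csin (beta * PI) * S).
Proof.
  destruct (exchange_limits beta gamma a hbeta hgamma ha hpole) as (l & Hsum & Hint).
  pose proof (ml_series beta gamma hpole) as Hml.
  set (c := RtoC PI * Cexp (- gamma * RtoC a) / (2 * gamma)).
  set (Lam := RtoC (PI / 2) * Csin (beta * PI) / (Ccos (gamma * PI) + Ccos (beta * PI))) in *.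
  pose proof (Csin_beta_neq_0 beta hbeta) as Hs.
  pose proof (Re_pos_neq_0 gamma hgamma) as Hg. pose proof PI_RGT_0.
  assert (HP : RtoC PI <> 0) by (apply RtoC_neq_0; lra).
  (* By [mode_limit_eq], [l] must be PI/2 times the sum of the series plus [c] times [Lam]; this
     solves for the sum. *)
  exists (2 / RtoC PI * (l + - c * Lam)); split.
  - apply filterlim_ext with (fun n => 2 / RtoC PI *
      (sum_n (G := C_AbelianMonoid) (mode_limit beta gamma a) n
       + - c * sum_n (G := C_AbelianMonoid) (ml_term beta (- gamma ^ 2)) n)).
    + intros n.
      rewrite (sum_n_ext (mode_limit beta gamma a) (fun k => RtoC (PI / 2) * series_term beta gamma a k
        + c * ml_term beta (- gamma ^ 2) k)) by (intros; now apply mode_limit_eq).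
      rewrite sum_n_Cplus, !sum_n_Cscal.
      replace (RtoC (PI / 2)) with (RtoC PI / 2) by (rewrite RtoC_div by lra; reflexivity).
      change (sum_n (series_term beta gamma a) n) with (sum_n (G := C_AbelianMonoid) (series_term beta gamma a) n).
      field; exact HP.
    + apply filterlim_Cscal; [apply eventually_filter|].
      apply filterlim_Cplus; [apply eventually_filter|exact Hsum|].
      apply filterlim_Cscal; [apply eventually_filter|exact Hml].
  - apply is_CInt_0_infty_intro with (fun X => 2 / (RtoC PI * Csin (beta * PI)) * trunc beta gamma a X).
    + intros X HX.
      eapply is_CInt_ext; [exact HX| |apply is_CInt_scal, trunc_correct; assumption].
      intros x _; symmetry; now apply integrand_eq.
    (* The sine in [Lam] cancels the one in the prefactor, and [c * Lam] becomes the closed term in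
       exp(- a gamma). *)
    + match goal with |- filterlim _ _ (locally ?y) =>
        replace y with (2 / (RtoC PI * Csin (beta * PI)) * l) end.
      * apply filterlim_Cscal; [apply Rbar_locally_filter|exact Hint].
      * unfold Lam, c. replace (RtoC (PI / 2)) with (RtoC PI / 2) by (rewrite RtoC_div by lra; reflexivity).
        replace (- (RtoC a * gamma)) with (- gamma * RtoC a) by ring.
        field; repeat split; assumption.
Qed.
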